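(* Let $\mathfrak{B}_n$ be the group of signed permutations of $\{\pm1,\dots,\pm n\}$ (bijections $\pi$ with $\pi(-i)=-\pi(i)$), written in window notation $\pi=\pi_1\cdots\pi_n$ with $\pi_i=\pi(i)$. Let $\mathrm{negs}(\pi)=|\{i\in[n]:\pi_i<0\}|$, $\mathrm{inv}_A(\pi)=|\{1\le i<j\le n:\pi_i>\pi_j\}|$ and $\mathrm{inv}_B(\pi)=\mathrm{inv}_A(\pi)+|\{1\le i<j\le n:-\pi_i>\pi_j\}|+\mathrm{negs}(\pi)$. Let $\mathfrak{B}_n^+=\{\pi\in\mathfrak{B}_n:\mathrm{inv}_B(\pi)\text{ even}\}$ and $\mathfrak{B}_n^-=\{\pi\in\mathfrak{B}_n:\mathrm{inv}_B(\pi)\text{ odd}\}$. With $\pi_0=0$, let $\mathrm{des}_B(\pi)=|\{i\in\{0,1,\dots,n-1\}:\pi_i>\pi_{i+1}\}|$, and let $\mathrm{exc}_B(\pi)=|\{i\in[n]:\pi_{|\pi_i|}>\pi_i\}\cup\{i\in[n]:\pi_i=-i\}|$. Define $B_n^{\pm}(t)=\sum_{\pi\in\mathfrak{B}_n^{\pm}}t^{\mathrm{des}_B(\pi)}$ and $\mathrm{BExc}_n^{\pm}(t)=\sum_{\pi\in\mathfrak{B}_n^{\pm}}t^{\mathrm{exc}_B(\pi)}$. Then the distribution of the coefficients of $\mathrm{BExc}_n^{+}(t)$ and of $\mathrm{BExc}_n^{-}(t)$ (and hence of $B_n^{+}(t)$ and $B_n^{-}(t)$) is asymptotically normal as $n\to\infty$.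 The random variables $X_{\mathrm{exc}_B}$ and $X_{\mathrm{des}_B}$ over $\mathfrak{B}_n^{\pm}$ (uniform distribution on $\mathfrak{B}_n^{+}$, resp. $\mathfrak{B}_n^-$) have mean $n/2$ when $n\ge 2$ and variance $(n+1)/12$ when $n\ge 3$.
   Context: To a polynomial $P(t)=\sum_k p_k t^k$ with nonnegative coefficients and $P(1)>0$ associate the random variable $X$ with $\Pr(X=k)=p_k/P(1)$. A sequence of such polynomials $P_n(t)=\sum_k p_{n,k}t^k$ has asymptotically normal coefficient distribution if, with $\mu_n,\sigma_n^2$ the mean and variance of the associated random variable, $\lim_{n\to\infty}\sup_{x\in\mathbb{R}}\left|\sum_{k\le\lfloor x\sigma_n+\mu_n\rfloor}\frac{p_{n,k}}{P_n(1)}-\Phi(x)\right|=0$, where $\Phi$ is the standard normal cumulative distribution function. For a statistic $\mathrm{stat}$ and a finite set $S$, $X_{\mathrm{stat}}$ over $S$ denotes $\mathrm{stat}(\pi)$ for $\pi$ uniform in $S$. *)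

(* Defs.v *)
From HB Require Import structures.
From mathcomp Require Import all_boot all_order all_algebra all_fingroup.
From mathcomp Require Import all_classical all_reals all_analysis.

Set Implicit Arguments.
Unset Strict Implicit.
Unset Printing Implicit Defensive.

Import Order.TTheory GRing.Theory Num.Theory.
Import numFieldNormedType.Exports.

Local Open Scope ring_scope.

(* The pair (i, b) stands for the element (-1)^b (i + 1) of {±1, ..., ±n}. *)
Definition letter (n : nat) : finType := ('I_n * bool)%type.

Definition letter_val (n : nat) (x : letter n) : int :=
  (-1) ^+ x.2 * (x.1.+1)%:Z.

Definition letter_opp (n : nat) (x : letter n) : letter n := (x.1, ~~ x.2).

Lemma letter_val_opp (n : nat) (x : letter n) :
  letter_val (letter_opp x) = - letter_val x.
Proof.
case: x => i [] /=; rewrite /letter_val /=;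
  by rewrite ?expr0 ?expr1 ?mulN1r ?mul1r ?opprK.
Qed.

Lemma letter_val_inj (n : nat) : injective (@letter_val n).
Proof.
move=> [i b] [j c]; rewrite /letter_val /= => h.
have hij : i = j.
  apply: val_inj; apply: succn_inj.
  by move: (congr1 absz h); rewrite !abszM !abszX /= !exp1n !mul1n.
by congr pair => //; case: b c h => [] [] //; rewrite hij.
Qed.

Lemma letter_val_surj (n : nat) (z : int) :
  (0 < `|z| <= n)%N -> exists x : letter n, letter_val x = z.
Proof.
case: z => [[//|k]|k] /= hk.
- by exists (Ordinal hk, false); rewrite /letter_val /= expr0 mul1r.
- by exists (Ordinal hk, true); rewrite /letter_val /= expr1 mulN1r NegzE.
Qed.

Definition signed_perms (n : nat) : {set {perm letter n}} :=
  [set pi : {perm letter n} |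
     [forall x, pi (letter_opp x) == letter_opp (pi x)]].

(* The window entry pi_k for 1 <= k <= n, together with the convention
   pi_0 = 0; the value is the junk 0 for k > n. *)
Definition window (n : nat) (pi : {perm letter n}) (k : nat) : int :=
  if k is j.+1 then
    if insub j is Some i then letter_val (pi (i, false)) else 0
  else 0.

(* In the statistics below an index i : 'I_n stands for the position i.+1,
   except in des_B where it stands for i itself. *)
Definition negs (n : nat) (pi : {perm letter n}) : nat :=
  #|[set i : 'I_n | window pi i.+1 < 0]|.

Definition inv_A (n : nat) (pi : {perm letter n}) : nat :=
  #|[set ij : 'I_n * 'I_n |
       (ij.1 < ij.2)%N && (window pi ij.1.+1 > window pi ij.2.+1)]|.

Definition inv_B (n : nat) (pi : {perm letter n}) : nat :=
  (inv_A pi +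
   #|[set ij : 'I_n * 'I_n |
        (ij.1 < ij.2)%N && (- window pi ij.1.+1 > window pi ij.2.+1)%R]| +
   negs pi)%N.

Definition des_B (n : nat) (pi : {perm letter n}) : nat :=
  #|[set i : 'I_n | window pi i > window pi i.+1]|.

Definition exc_B (n : nat) (pi : {perm letter n}) : nat :=
  #|[set i : 'I_n | window pi `|window pi i.+1|%N > window pi i.+1] :|:
    [set i : 'I_n | window pi i.+1 == - (i.+1)%:Z]|.

Definition signed_perms_plus (n : nat) : {set {perm letter n}} :=
  [set pi in signed_perms n | ~~ odd (inv_B pi)].

Definition signed_perms_minus (n : nat) : {set {perm letter n}} :=
  [set pi in signed_perms n | odd (inv_B pi)].

Section polynomials.
Local Open Scope classical_set_scope.
Variable R : realType.

Definition stat_poly (T : finType) (S : {set T}) (stat : T -> nat) : {poly R} :=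
  \sum_(x in S) 'X^(stat x).

Definition B_plus (n : nat) : {poly R} :=
  stat_poly (signed_perms_plus n) (@des_B n).
Definition B_minus (n : nat) : {poly R} :=
  stat_poly (signed_perms_minus n) (@des_B n).
Definition BExc_plus (n : nat) : {poly R} :=
  stat_poly (signed_perms_plus n) (@exc_B n).
Definition BExc_minus (n : nat) : {poly R} :=
  stat_poly (signed_perms_minus n) (@exc_B n).

Definition unif_mean (T : finType) (S : {set T}) (stat : T -> nat) : R :=
  (\sum_(x in S) (stat x)%:R) / #|S|%:R.

Definition unif_var (T : finType) (S : {set T}) (stat : T -> nat) : R :=
  (\sum_(x in S) ((stat x)%:R - unif_mean S stat) ^+ 2) / #|S|%:R.

Definition has_coef_distr (P : {poly R}) : Prop :=
  (forall k, 0 <= P`_k) /\ 0 < P.[1].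

Definition coef_prob (P : {poly R}) (k : nat) : R := P`_k / P.[1].

Definition coef_mean (P : {poly R}) : R :=
  \sum_(k < size P) k%:R * coef_prob P k.

Definition coef_var (P : {poly R}) : R :=
  \sum_(k < size P) (k%:R - coef_mean P) ^+ 2 * coef_prob P k.

Definition std_normal_cdf (x : R) : R := fine (normal_prob 0 1 `]-oo, x]).

Definition normal_distance (P : {poly R}) : R :=
  sup [set `| (\sum_(k < size P |
                 k%:Z <= Num.floor (x * Num.sqrt (coef_var P) + coef_mean P))
                coef_prob P k)
              - std_normal_cdf x | | x in [set: R]].

(* Positivity of P_n(1) is only required eventually: for signed permutations
   the odd class is empty when n = 0. *)
Definition asymptotically_normal (P : nat -> {poly R}) : Prop :=
  (\forall n \near \oo, has_coef_distr (P n)) /\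
  normal_distance (P n) @[n --> \oo] --> (0 : R).

End polynomials.

(* Main.v *)
Require Import Defs.
From HB Require Import structures.
From mathcomp Require Import all_boot all_order all_algebra all_fingroup.
From mathcomp Require Import all_classical all_reals all_analysis.
From mathcomp Require Import zify ring lra polyrcf measurable_realfun.
Import Order.TTheory GRing.Theory Num.Theory.
Import numFieldNormedType.Exports.
Local Open Scope classical_set_scope.
Local Open Scope ring_scope.

Set Implicit Arguments.
Unset Strict Implicit.
Unset Printing Implicit Defensive.

(** A signed permutation is a permutation [s] together with a choice of signs.
    For fixed [s], both [des_B] and [exc_B] are sums over the positions of
    quantities that depend only on the sign at that position, while [inv_B] is
    congruent modulo 2 to the number of minus signs plus a function of [s].
    Hence sums over the signs factor. In the sum weighted by [(-1)^inv_B] every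
    [s] but the identity contributes 0, which leaves [(1 - t)^n]; in the
    unweighted sum [s] contributes [(4 t)^p (1 + t)^(n - 2 p)], where [p] is its
    number of (linear, resp. cyclic) peaks. Inserting the largest letter gives
    the same recurrence for both kinds of peaks, so both unweighted sums equal
    the polynomial [B_n] defined by [B_{n+1} = ((2 n + 1) t + 1) B_n +
    2 t (1 - t) B_n']. Thus the four polynomials are [(B_n ± (1 - t)^n) / 2];
    [(1 - t)^n] does not affect the derivatives of order at most 2 at 1, which
    gives the mean and the variance, and changes the expectation of a function
    bounded by 1 by at most [1 / n!]. Finally [B_n] has only negative real
    roots, so it is, up to a factor, the generating polynomial of a sum of
    independent Bernoulli variables, whose variance tends to infinity: it is
    asymptotically normal by Stein's method, and uniformly so by Polya's theorem
    on the convergence of distribution functions. *)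

Local Arguments window : simpl never.

(** * Sums over choices of signs *)

Section sums_of_bits.
Variable n : nat.
Implicit Types a b : 'I_n -> bool.

Lemma prod_sum_signs (A : comNzRingType) (t q : A) a b :
  \prod_i (t ^+ (~~ b i) + q * t ^+ a i) =
  \sum_(e : {ffun 'I_n -> bool})
    q ^+ (\sum_i e i)%N * t ^+ (\sum_i (if e i then a i else ~~ b i))%N.
Proof.
pose F i (c : bool) := q ^+ c * t ^+ (if c then a i else ~~ b i).
rewrite (eq_bigr (fun i => \sum_c F i c)) => [|i _]; last first.
  by rewrite big_bool /F expr0 expr1 mul1r addrC.
rewrite bigA_distr_bigA; apply: eq_bigr => e _.
by rewrite !expr_sum -big_split.
Qed.

Definition npeaks a b : nat := (\sum_i (a i && ~~ b i))%N.

Lemma npeaksC a b : (\sum_i a i = \sum_i b i)%N -> npeaks a b = npeaks b a.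
Proof.
have sumE (c d : 'I_n -> bool) : (\sum_i c i = \sum_i (c i && d i) + npeaks c d)%N.
  by rewrite -big_split; apply: eq_bigr => i _; case: (c i); case: (d i).
have andC : (\sum_i (a i && b i) = \sum_i (b i && a i))%N.
  by apply: eq_bigr => i _; rewrite andbC.
by rewrite (sumE a b) (sumE b a) andC => /addnI.
Qed.

Lemma npeaks_partition a b :
  (npeaks a b + npeaks b a + \sum_i (a i == b i) = n)%N.
Proof.
rewrite -!big_split /= -[RHS]card_ord -sum1_card.
by apply: eq_bigr => i _; case: (a i); case: (b i).
Qed.

Lemma double_npeaks_le a b : (\sum_i a i = \sum_i b i)%N -> ((npeaks a b).*2 <= n)%N.
Proof. by move=> /npeaksC balanced; have := npeaks_partition a b; lia. Qed.

(* A position with [a i && ~~ b i] contributes [2 t], one with [~~ a i && b i]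
   contributes [2], and any other position [1 + t]. *)
Lemma prod_balanced_bits (A : comNzRingType) (t : A) a b :
  (\sum_i a i = \sum_i b i)%N ->
  \prod_i (t ^+ (~~ b i) + t ^+ a i) =
  (4 * t) ^+ npeaks a b * (1 + t) ^+ (n - (npeaks a b).*2).
Proof.
move=> /npeaksC balanced.
have -> : (n - (npeaks a b).*2 = \sum_i (a i == b i))%N.
  by have := npeaks_partition a b; lia.
have -> : 4 * t = 2 * t * 2 by ring.
rewrite exprMn {2}balanced !expr_sum -!big_split /=; apply: eq_bigr => i _.
by case: (a i); case: (b i); rewrite /= ?expr0 ?expr1; ring.
Qed.

End sums_of_bits.

(** * Signed permutations *)

Section signed_permutations.
Variable n : nat.
Implicit Types (s : 'S_n) (e : {ffun 'I_n -> bool}) (pi : {perm letter n}).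

Definition signed_fun s e (x : letter n) : letter n := (s x.1, e x.1 (+) x.2).

Lemma signed_fun_inj s e : injective (signed_fun s e).
Proof. by move=> [i b] [j c] [] /perm_inj -> /addbI ->. Qed.

Definition signed_perm s e : {perm letter n} := perm (@signed_fun_inj s e).

Lemma signed_permE s e x : signed_perm s e x = (s x.1, e x.1 (+) x.2).
Proof. by rewrite permE. Qed.

Lemma mem_signed_perm s e : signed_perm s e \in signed_perms n.
Proof.
rewrite inE; apply/forallP => -[i b]; apply/eqP.
by rewrite !signed_permE /letter_opp /= addbN.
Qed.

Lemma signed_perm_abs_inj pi :
  pi \in signed_perms n -> injective (fun i => (pi (i, false)).1).
Proof.
rewrite inE => /forallP signed i j eq_abs.
have opp_j : pi (j, true) = letter_opp (pi (j, false)) := eqP (signed (j, false)).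
have : pi (i, false) = pi (j, false) \/ pi (i, false) = pi (j, true).
  rewrite opp_j; move: eq_abs.
  by case: (pi (i, false)) (pi (j, false)) => k [] [l []] /= ->; auto.
by case=> /perm_inj [].
Qed.

Lemma signed_perm_surj pi :
  pi \in signed_perms n -> exists s, exists e, pi = signed_perm s e.
Proof.
move=> signed; exists (perm (signed_perm_abs_inj signed)).
exists [ffun i => (pi (i, false)).2].
apply/permP => -[i b]; rewrite signed_permE permE ffunE /=.
move: signed; rewrite inE => /forallP /(_ (i, false)) /eqP.
rewrite /letter_opp /=; case: b => [->|_]; last by rewrite addbF -surjective_pairing.
by rewrite addbT.
Qed.

Lemma signed_perm_inj s s' e e' :
  signed_perm s e = signed_perm s' e' -> s = s' /\ e = e'.
Proof.
move=> /permP eq_perm; split; [apply/permP | apply/ffunP] => i;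
  by have := eq_perm (i, false); rewrite !signed_permE /= !addbF => -[].
Qed.

Lemma big_signed_perms (V : nmodType) (F : {perm letter n} -> V) :
  \sum_(pi in signed_perms n) F pi = \sum_s \sum_e F (signed_perm s e).
Proof.
rewrite pair_bigA /= -(big_imset (h := fun p => signed_perm p.1 p.2) F) /=.
  apply: eq_bigl => pi; apply/idP/imsetP => [/signed_perm_surj[s [e ->]]|].
    by exists (s, e).
  by move=> [[s e] _ ->]; apply: mem_signed_perm.
by move=> [s e] [s' e'] _ _ /= /signed_perm_inj [-> ->].
Qed.

Lemma window_signed_perm s e (i : 'I_n) :
  window (signed_perm s e) i.+1 = (-1) ^+ e i * (s i).+1%:Z.
Proof. by rewrite /window valK /letter_val signed_permE /= addbF. Qed.

Lemma negs_signed_perm s e : negs (signed_perm s e) = (\sum_i e i)%N.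
Proof.
rewrite /negs -sum1dep_card big_mkcond /=; apply: eq_bigr => i _.
by rewrite window_signed_perm; case: (e i); rewrite ?mulN1r ?mul1r.
Qed.

Definition inversions s : nat :=
  (\sum_(ij : 'I_n * 'I_n) ((ij.1 < ij.2) && (s ij.2 < s ij.1)))%N.

Lemma inversions1 : inversions 1 = 0%N.
Proof. by rewrite /inversions big1 // => -[i j] _ /=; rewrite !perm1; case: ltngtP. Qed.

(* For [i < j], the pairs counted by [inv_A] and by the second term of [inv_B]
   have the parity of [s j < s i], whatever the signs are. *)
Lemma odd_inv_B s e :
  odd (inv_B (signed_perm s e)) = odd (inversions s) (+) odd (\sum_i e i).
Proof.
rewrite /inv_B oddD negs_signed_perm; congr (_ (+) _).
rewrite /inv_A -!sum1dep_card !(big_mkcond (fun _ => _ && _)) /= -big_split /=.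
rewrite /inversions !(big_morph odd oddD (erefl _)).
apply: eq_bigr => -[i j] _ /=; rewrite !window_signed_perm.
case: ltnP => //= lt_ij.
have : s i != s j by rewrite (inj_eq perm_inj) neq_ltn lt_ij.
rewrite -val_eqE /=.
case: (e i); case: (e j); rewrite ?expr1 ?expr0 ?mulN1r ?mul1r;
  case: ltngtP => // ? _; do ?[case: Order.TotalTheory.ltP => ? //]; rewrite //=; lia.
Qed.

Definition sign_separable (stat : {perm letter n} -> nat) (a b : 'S_n -> 'I_n -> bool) : Prop :=
  forall s e, stat (signed_perm s e) = (\sum_i (if e i then a s i else ~~ b s i))%N.

Section sign_separable_statistic.
Variables (stat : {perm letter n} -> nat) (a b : 'S_n -> 'I_n -> bool).
Variables (A : comNzRingType) (t : A).
Hypothesis stat_sep : sign_separable stat a b.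

(* If the bits of [s] differ at some position, the two signs there cancel. *)
Lemma alternating_sum_signed_perms :
  (forall s, a s =1 b s -> s = 1%g) -> a 1%g =1 xpredT -> b 1%g =1 xpredT ->
  \sum_(pi in signed_perms n) (-1) ^+ inv_B pi * t ^+ stat pi = (1 - t) ^+ n.
Proof.
move=> ab1 a1 b1; rewrite big_signed_perms.
transitivity (\sum_(s : 'S_n) (-1) ^+ odd (inversions s) *
    \prod_i (t ^+ (~~ b s i) + (-1) * t ^+ a s i)).
  apply: eq_bigr => s _; rewrite prod_sum_signs big_distrr /=.
  apply: eq_bigr => e _; rewrite stat_sep mulrA -signr_odd odd_inv_B signr_addb.
  by rewrite (signr_odd _ (\sum_i e i)).
rewrite (bigD1 1%g) //= inversions1 mul1r [X in _ + X]big1 ?addr0.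
  rewrite (eq_bigr (fun=> 1 - t)) ?prodr_const ?card_ord // => i _.
  by rewrite a1 b1 mulN1r.
move=> s s_neq1.
have [i neq_ab|eq_ab] := pickP (fun i => a s i != b s i); last first.
  by case/eqP: s_neq1; apply: ab1 => i; apply/eqP; rewrite -[_ == _]negbK eq_ab.
rewrite (bigD1 i) //=; case: (a s i) (b s i) neq_ab => [] [] //= _;
  by rewrite mulN1r subrr mul0r mulr0.
Qed.

Lemma sum_signed_perms_npeaks :
  (forall s, \sum_i a s i = \sum_i b s i)%N ->
  \sum_(pi in signed_perms n) t ^+ stat pi =
  \sum_(s : 'S_n) (4 * t) ^+ npeaks (a s) (b s) * (1 + t) ^+ (n - (npeaks (a s) (b s)).*2).
Proof.
move=> balanced; rewrite big_signed_perms; apply: eq_bigr => s _.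
rewrite -prod_balanced_bits //.
under [RHS]eq_bigr => i _ do rewrite -[t ^+ a s i]mul1r.
by rewrite prod_sum_signs; apply: eq_bigr => e _; rewrite expr1n mul1r stat_sep.
Qed.

End sign_separable_statistic.
End signed_permutations.

(** * Excedances and descents of type B *)

Section excedances.
Variable n : nat.
Implicit Types (s : 'S_n) (j : 'I_n).

Definition anti_exc s j : bool := (s j <= j)%N.

Lemma perm_le_id s : (forall j, s j <= j)%N -> s = 1%g.
Proof.
move=> le_s; have : (\sum_j s j == \sum_(j < n) j)%N.
  by rewrite [X in _ == X](reindex_inj (@perm_inj _ s)).
rewrite (leqif_sum (fun j _ => leqif_eq (le_s j))) => /forallP eq_s.
by apply/permP => j; rewrite perm1; apply/val_inj/eqP/eq_s.
Qed.

(* Were [j < s j] for some [j], the excedances would propagate along the orbit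
   of [j], which would increase forever. *)
Lemma anti_exc_shift_id s : anti_exc s \o s =1 anti_exc s -> s = 1%g.
Proof.
move=> shift; apply: perm_le_id => j.
have [m] := ubnP (n - j)%N; elim: m j => // m IHm j; rewrite ltnS => le_m.
rewrite leqNgt; apply/negP => lt_j.
have : (anti_exc s \o s) j by apply: IHm; have := ltn_ord (s j); lia.
by rewrite shift /anti_exc leqNgt lt_j.
Qed.

Lemma anti_exc_balanced s : (\sum_j anti_exc s (s j) = \sum_j anti_exc s j)%N.
Proof. by rewrite [RHS](reindex_inj (@perm_inj _ s)). Qed.

(* Whether [exc_B] counts the position [i] depends on the signs at [i] and at
   [s i]; the contribution of a positive sign at [s i] is charged to [s i]. *)
Lemma exc_B_separable :
  sign_separable (@exc_B n) (fun s j => anti_exc s (s j)) (@anti_exc).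
Proof.
move=> s e; pose pos_exc j := (~~ e j && (j < s j)%N : nat).
have pos_exc_shift : (\sum_j pos_exc (s j) = \sum_j pos_exc j)%N.
  by rewrite [RHS](reindex_inj (@perm_inj _ s)).
transitivity (\sum_j ((e j && anti_exc s (s j)) + pos_exc (s j)))%N; last first.
  rewrite big_split /= pos_exc_shift -big_split /=; apply: eq_bigr => j _.
  by rewrite /pos_exc /anti_exc; case: (e j); rewrite ?addn0 // -ltnNge.
rewrite /exc_B -sum1_card big_mkcond /=; apply: eq_bigr => i _.
rewrite !inE window_signed_perm abszM absz_sign mul1n absz_nat window_signed_perm.
rewrite /anti_exc /pos_exc.
have fixed_next : (s (s i) == s i :> nat) = (s i == i :> nat).
  by rewrite !val_eqE (inj_eq perm_inj).
have fixed_sign : (s i == i :> nat) -> e (s i) = e i by move=> /eqP /val_inj ->.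
move: (e (s i)) (e i) fixed_sign fixed_next => x y.
move: (nat_of_ord (s (s i))) (nat_of_ord (s i)) (nat_of_ord i) => c b a.
case: x y => [] []; rewrite ?expr1 ?expr0 ?mulN1r ?mul1r /= => ? ?.
all: do ?[case: ifP => ?]; lia.
Qed.

End excedances.

Section descents.
Variable n : nat.
Implicit Type s : 'S_n.

(* The word of [s] read from position 1, preceded by 0 and followed by letters
   larger than n. *)
Definition word s (k : nat) : nat :=
  if k is j.+1 then
    if insub j is Some i then (s (i : 'I_n)).+1 else (n + k)%N
  else 0%N.

Lemma word_ord s (i : 'I_n) : word s i.+1 = (s i).+1.
Proof. by rewrite /word valK. Qed.

Lemma word_gt s k : (n <= k)%N -> word s k.+1 = (n + k.+1)%N.
Proof. by rewrite leqNgt => nk; rewrite /word insubN. Qed.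

Lemma word_le s k : (k <= n)%N -> (word s k <= n)%N.
Proof. by case: k => // k lt_kn; rewrite (word_ord s (Ordinal lt_kn)). Qed.

Lemma word_gt0 s k : (0 < k)%N -> (0 < word s k)%N.
Proof. by case: k => // k _; rewrite /word; case: insub => //=; lia. Qed.

Lemma word_neqS s k : (k < n)%N -> word s k != word s k.+1.
Proof.
case: k => [|k] lt_kn; first by rewrite (word_ord s (Ordinal lt_kn)).
rewrite (word_ord s (Ordinal lt_kn)) (word_ord s (Ordinal (ltnW lt_kn))) eqSS.
by rewrite val_eqE (inj_eq perm_inj) -val_eqE /= neq_ltn ltnSn.
Qed.

Lemma word1 k : (k <= n)%N -> word 1 k = k.
Proof. by case: k => // k lt_kn; rewrite (word_ord 1%g (Ordinal lt_kn)) perm1. Qed.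

Definition asc s (k : nat) : bool := (word s k < word s k.+1)%N.

Lemma asc0 s : asc s 0. Proof. exact: word_gt0. Qed.

Lemma asc_last s : asc s n.
Proof. by rewrite /asc word_gt // (leq_ltn_trans (word_le s _)) //; lia. Qed.

Lemma asc1 k : (k <= n)%N -> asc 1 k.
Proof.
rewrite leq_eqVlt => /orP [/eqP ->|lt_kn]; first exact: asc_last.
by rewrite /asc !word1 // ltnW.
Qed.

Lemma asc_shift_id s : (forall i : 'I_n, asc s i = asc s i.+1) -> s = 1%g.
Proof.
move=> shift.
have asc_all k : (k <= n)%N -> asc s k.
  elim: k => [|k IHk] lt_kn; first exact: asc0.
  by rewrite -(shift (Ordinal lt_kn)) IHk // ltnW.
have ge_word k : (k <= n)%N -> (k <= word s k)%N.
  by elim: k => // k IHk lt_kn; apply: leq_ltn_trans (IHk (ltnW lt_kn)) (asc_all k (ltnW lt_kn)).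
have ge_s (j : 'I_n) : (j <= s j)%N by have := ge_word j.+1 (ltn_ord j); rewrite word_ord.
apply/eqP; rewrite -invg_eq1; apply/eqP/perm_le_id => j.
by rewrite (leq_trans (ge_s _)) // permKV.
Qed.

Lemma sum_ord_shift (f : nat -> nat) :
  f 0%N = f n -> (\sum_(i < n) f i = \sum_(i < n) f i.+1)%N.
Proof.
move=> f0n; have : (\sum_(i < n.+1) f i = \sum_(i < n.+1) f i)%N by [].
by rewrite {1}big_ord_recr big_ord_recl /= f0n addnC => /addnI.
Qed.

Lemma asc_balanced s : (\sum_(i < n) asc s i = \sum_(i < n) asc s i.+1)%N.
Proof. by apply: (@sum_ord_shift (asc s)); rewrite asc0 asc_last. Qed.

(* Whether [des_B] counts the pair of positions [(i, i + 1)] depends on both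
   signs; a positive sign at [i] is charged to the pair [(i - 1, i)]. *)
Lemma des_B_separable :
  sign_separable (@des_B n) (fun s i => asc s i) (fun s i => asc s i.+1).
Proof.
move=> s e; pose neg k := if k is j.+1 then oapp e false (insub j) else false.
have neg_ord (i : 'I_n) : neg i.+1 = e i by rewrite /neg valK.
have windowE k : (k <= n)%N -> window (signed_perm s e) k = (-1) ^+ neg k * (word s k)%:Z.
  case: k => [|k] lt_kn; first by rewrite mulr0.
  rewrite (window_signed_perm s e (Ordinal lt_kn)) (word_ord s (Ordinal lt_kn)).
  by rewrite (neg_ord (Ordinal lt_kn)).
pose pos_des k : nat := ~~ asc s k && ~~ neg k.
have pos_des_shift : (\sum_(i < n) pos_des i = \sum_(i < n) pos_des i.+1)%N.
  by apply: sum_ord_shift; rewrite /pos_des asc0 asc_last.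
transitivity (\sum_(i < n) ((asc s i && e i) + pos_des i))%N; last first.
  rewrite big_split /= pos_des_shift -big_split /=; apply: eq_bigr => i _.
  by rewrite /pos_des neg_ord; case: (e i); rewrite /= ?andbT ?andbF ?addn0.
rewrite /des_B -sum1dep_card big_mkcond /=; apply: eq_bigr => i _.
rewrite !windowE // 1?ltnW // neg_ord /pos_des /asc.
have neq_word := word_neqS s (ltn_ord i).
have neg_gt0 : neg i -> (0 < word s i)%N by case: (val i) => // k _; apply: word_gt0.
move: (neg i) (e i) (word s i) (word s i.+1) neq_word neg_gt0 => x y a b.
case: x y => [] []; rewrite ?expr1 ?expr0 ?mulN1r ?mul1r /= => ? ?;
  do ?[case: Order.TotalTheory.ltP => ?]; do ?[case: ltnP => ?]; rewrite //=; lia.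
Qed.

End descents.

(** * Inserting the largest letter *)

Definition peak_recurrence (pk : forall n, 'S_n -> nat) : Prop :=
  forall (V : nmodType) (n : nat) (F : nat -> V),
  \sum_(s : 'S_n.+1) F (pk _ s) =
  \sum_(s : 'S_n) (F (pk _ s) *+ (pk _ s).*2.+1 +
                   F (pk _ s).+1 *+ (n - (pk _ s).*2)).

Lemma sum_one_or_succ (V : nmodType) (F : nat -> V) (n m p : nat) (v c : 'I_n -> nat) :
  (\sum_i c i = m)%N -> (forall i, c i <= 1)%N -> (forall i, v i + c i = p.+1)%N ->
  \sum_i F (v i) = F p *+ m + F p.+1 *+ (n - m).
Proof.
move=> sum_c c_le1 vc.
transitivity (\sum_i (F p *+ c i + F p.+1 *+ (1 - c i))).
  apply: eq_bigr => i _; have := vc i; have := c_le1 i.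
  case: (c i) => [|[|//]] _; first by rewrite addn0 => ->; rewrite mulr0n mulr1n add0r.
  by rewrite addn1 => -[->]; rewrite mulr1n mulr0n addr0.
rewrite big_split /= !sumrMnr sum_c; congr (_ + _ *+ _).
have : (\sum_i (1 - c i) + \sum_i c i = n)%N.
  rewrite -big_split /= -[RHS]card_ord -sum1_card; apply: eq_bigr => i _.
  by rewrite subnK.
by rewrite sum_c => sum_n; rewrite -[RHS](congr1 (subn^~ m) sum_n) addnK.
Qed.

Lemma big_ord_lift_max (T : Type) (idx : T) (op : Monoid.law idx) (n : nat)
    (F : 'I_n.+1 -> T) :
  \big[op/idx]_i F i = op (\big[op/idx]_j F (lift ord_max j)) (F ord_max).
Proof.
rewrite big_ord_recr; congr (op _ _); apply: eq_bigr => j _; congr F.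
exact/val_inj/esym/lift_max.
Qed.

Section insertion.
Variables (n : nat) (ins : 'I_n.+1 -> 'S_n -> 'S_n.+1).
Hypothesis ins_at : forall i s, ins i s i = ord_max.
Hypothesis ins_inj : forall i, injective (ins i).

Lemma big_perm_insertion (V : nmodType) (F : 'S_n.+1 -> V) :
  \sum_s F s = \sum_(s : 'S_n) \sum_i F (ins i s).
Proof.
rewrite exchange_big pair_bigA /=.
apply: (reindex (fun p : 'I_n.+1 * 'S_n => ins p.1 p.2)).
apply/onW_bij/inj_card_bij; last by rewrite card_prod card_ord !card_Sn factS.
move=> [i s] [j r] /= eq_ins; have eq_ij : i = j.
  by apply: (@perm_inj _ (ins i s)); rewrite {2}eq_ins !ins_at.
by rewrite -eq_ij in eq_ins *; rewrite (ins_inj eq_ins).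
Qed.

End insertion.

(* Inserting the largest letter at a position [j] makes a peak there and
   destroys those at [j] and at the position [k] preceding [j], if any. As [j]
   and [k] are never both peaks, the [2 p] choices of [j] next to one of the [p]
   peaks give [p] peaks, and the [n - 2 p] others give [p + 1] peaks. *)
Lemma sum_peak_insertion (V : nmodType) (F : nat -> V) (n : nat)
    (peak : 'I_n -> bool) (next : 'I_n -> nat) (v : 'I_n.+1 -> nat) :
  injective next -> (forall k, peak k -> next k < n)%N ->
  (forall j k : 'I_n, peak k -> next k = j -> ~~ peak j) ->
  v ord_max = (\sum_k peak k)%N ->
  (forall j, v (lift ord_max j) =
     \sum_k (if k == j then true else if next k == j then false else peak k))%N ->
  \sum_i F (v i) =
  F (\sum_k peak k)%N *+ (\sum_k peak k).*2.+1 +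
  F (\sum_k peak k).+1 *+ (n - (\sum_k peak k).*2).
Proof.
set p := (\sum_k peak k)%N => next_inj next_lt apart v_max v_lift.
rewrite big_ord_lift_max v_max mulrSr addrAC; congr (_ + _).
pose before j := (\sum_(k | next k == j) peak k)%N.
have before_le j : (peak j + before j <= 1)%N.
  have [k /eqP next_k|none] := pickP (fun k => next k == j :> nat); last first.
    by rewrite /before big_pred0 // addn0 leq_b1.
  rewrite /before (big_pred1 k) => [|l]; last by rewrite -next_k (inj_eq next_inj).
  by have := apart j k; case: (peak k) => [/(_ isT next_k) /negbTE ->|_] //; rewrite addn0 leq_b1.
apply: (@sum_one_or_succ _ _ _ _ _ _ (fun j => peak j + before j)%N) => // [|j].
  rewrite big_split -addnn /=; congr (_ + _)%N.
  rewrite (exchange_big_dep xpredT) //=; apply: eq_bigr => k _.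
  have [peak_k|/negbTE peak_k] := boolP (peak k); last by rewrite big1.
  by rewrite (big_pred1 (Ordinal (next_lt k peak_k))).
have -> : p.+1 = (\sum_k (peak k + if k == j then 1 else 0))%N.
  by rewrite big_split /= -[X in (_ + X)%N]big_mkcond big_pred1_eq addn1.
have -> : peak j = (\sum_k (if k == j then peak k : nat else 0))%N :> nat.
  by rewrite -big_mkcond big_pred1_eq.
rewrite v_lift /before [X in (_ + (_ + X))%N]big_mkcond /= -!big_split /=.
apply: eq_bigr => k _; have [->|neq_kj] := eqVneq k j; last by case: eqP; rewrite ?addn0.
by have := apart j j; case: eqP => next_j; case: (peak j) => // /(_ isT next_j).
Qed.

(** * Cyclic peaks *)

Definition cyc_peak n (s : 'S_n) (j : 'I_n) : bool := anti_exc s (s j) && ~~ anti_exc s j.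
Definition cyc_peaks n (s : 'S_n) : nat := npeaks (fun j => anti_exc s (s j)) (anti_exc s).

Section cycle_insertion.
Variable n : nat.
Implicit Types (s : 'S_n) (j k : 'I_n).

(* Inserts the largest letter in the cycle of [s] that contains [i], right after
   [i], or as a fixed point if [i] is [ord_max]. *)
Definition cycle_insert (i : 'I_n.+1) s : 'S_n.+1 :=
  (tperm i ord_max * lift_perm ord_max ord_max s)%g.

Lemma cycle_insert_at i s : cycle_insert i s i = ord_max.
Proof. by rewrite permM tpermL lift_perm_id. Qed.

Lemma cycle_insert_inj i : injective (cycle_insert i).
Proof.
move=> s r /mulgI /permP eq_lift; apply/permP => k.
by have := eq_lift (lift ord_max k); rewrite !lift_perm_lift => /lift_inj.
Qed.

Lemma cycle_insert_ord_max j s :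
  cycle_insert (lift ord_max j) s ord_max = lift ord_max (s j).
Proof. by rewrite permM tpermR lift_perm_lift. Qed.

Lemma cycle_insert_neq i s k :
  lift ord_max k != i -> cycle_insert i s (lift ord_max k) = lift ord_max (s k).
Proof. by move=> neq_ki; rewrite permM tpermD ?lift_perm_lift 1?eq_sym // eq_sym neq_lift. Qed.

Lemma cyc_peaks_lift_max (r : 'S_n.+1) :
  cyc_peaks r = (\sum_k cyc_peak r (lift ord_max k))%N.
Proof.
rewrite /cyc_peaks /npeaks big_ord_lift_max /= [X in (_ + X)%N](_ : _ = 0%N) ?addn0 //.
by rewrite /anti_exc -[X in ~~ X]ltnS ltn_ord andbF.
Qed.

Lemma cyc_peaks_cycle_insert_max s : cyc_peaks (cycle_insert ord_max s) = cyc_peaks s.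
Proof.
rewrite cyc_peaks_lift_max; apply: eq_bigr => k _.
by rewrite /cyc_peak /anti_exc !cycle_insert_neq ?lift_max // eq_sym neq_lift.
Qed.

Lemma cyc_peak_cycle_insert_lift j s k :
  cyc_peak (cycle_insert (lift ord_max j) s) (lift ord_max k) =
  if k == j then true else if s k == j then false else cyc_peak s k.
Proof.
have insE l : l != j ->
    cycle_insert (lift ord_max j) s (lift ord_max l) = lift ord_max (s l).
  by move=> neq_lj; rewrite cycle_insert_neq // (inj_eq lift_inj).
rewrite /cyc_peak /anti_exc; have [->|neq_kj] := eqVneq k j.
  by rewrite cycle_insert_at cycle_insert_ord_max -ltnNge !lift_max /= ltn_ord ltnW.
rewrite insE //; have [->|neq_sk] := eqVneq (s k) j.
  by rewrite cycle_insert_at lift_max leqNgt ltn_ord.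
by rewrite insE // !lift_max.
Qed.

End cycle_insertion.

Lemma cyc_peaks_recurrence : peak_recurrence cyc_peaks.
Proof.
move=> V n F; rewrite (big_perm_insertion (@cycle_insert_at n) (@cycle_insert_inj n)).
apply: eq_bigr => s _.
apply: (@sum_peak_insertion _ _ _ (cyc_peak s) (fun k => s k)) => //.
- by move=> j k /val_inj /perm_inj.
- by move=> j k /andP [peak_k _] /val_inj <-; rewrite /cyc_peak peak_k andbF.
- exact: cyc_peaks_cycle_insert_max.
move=> j; rewrite cyc_peaks_lift_max; apply: eq_bigr => k _.
by rewrite cyc_peak_cycle_insert_lift.
Qed.

(** * Peaks of words *)

Section word_insertion.
Variables (n : nat) (s : 'S_n) (i : 'I_n.+1).
Let r : 'S_n.+1 := lift_perm i ord_max s.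

Lemma word_insert_at : word r i.+1 = n.+1.
Proof. by rewrite word_ord lift_perm_id. Qed.

Lemma word_insert_lift (k : 'I_n) : word r (lift i k).+1 = word s k.+1.
Proof. by rewrite !word_ord lift_perm_lift lift_max. Qed.

Lemma word_insert_before k : (k <= i)%N -> word r k = word s k.
Proof.
case: k => // k lt_ki; have lt_kn : (k < n)%N by have := ltn_ord i; lia.
have -> : k = lift i (Ordinal lt_kn) by rewrite /= /bump leqNgt lt_ki.
by rewrite word_insert_lift /= /bump leqNgt lt_ki.
Qed.

Lemma word_insert_after k : (i < k <= n)%N -> word r k.+1 = word s k.
Proof.
case: k => // k /andP [lt_ik lt_kn].
have lift_k : k.+1 = lift i (Ordinal lt_kn) by rewrite /= /bump -ltnS lt_ik.
by rewrite {1}lift_k word_insert_lift.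
Qed.

Lemma asc_insert_before k : (k < i)%N -> asc r k = asc s k.
Proof. by move=> lt_ki; rewrite /asc !word_insert_before // ltnW. Qed.

Lemma asc_insert_at : asc r i.
Proof. by rewrite /asc word_insert_at word_insert_before // ltnS word_le // -ltnS. Qed.

Lemma asc_insert_next : (i < n)%N -> asc r i.+1 = false.
Proof.
move=> lt_in; rewrite /asc word_insert_at word_insert_after ?ltnSn //.
by apply/negbTE; rewrite -leqNgt ltnW // ltnS word_le.
Qed.

Lemma asc_insert_after k : (i < k <= n)%N -> asc r k.+1 = asc s k.
Proof.
case/andP=> lt_ik; rewrite leq_eqVlt => /orP [/eqP ->|lt_kn].
  by rewrite (asc_last r) asc_last.
by rewrite /asc !word_insert_after // ?lt_ik ?(ltnW lt_kn) // ltnW.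
Qed.

End word_insertion.

Lemma lift_perm_max_inj n (i : 'I_n.+1) : injective (fun s : 'S_n => lift_perm i ord_max s).
Proof.
move=> s r /permP eq_lift; apply/permP => k.
by have := eq_lift (lift i k); rewrite !lift_perm_lift => /lift_inj.
Qed.

Definition lin_peak n (s : 'S_n) (k : nat) : bool := asc s k && ~~ asc s k.+1.
Definition lin_peaks n (s : 'S_n) : nat :=
  npeaks (fun i : 'I_n => asc s i) (fun i : 'I_n => asc s i.+1).

Lemma lin_peaks_insert_max n (s : 'S_n) :
  lin_peaks (lift_perm ord_max ord_max s) = lin_peaks s.
Proof.
rewrite /lin_peaks /npeaks big_ord_recr /= asc_last andbF addn0.
apply: eq_bigr => k _; rewrite asc_insert_before //.
have [lt_kn|le_nk] := ltnP k.+1 n; first by rewrite asc_insert_before.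
have -> : k.+1 = n by apply/eqP; rewrite eqn_leq le_nk ltn_ord.
by rewrite asc_last (asc_insert_at s ord_max).
Qed.

Lemma lin_peaks_insert_lift n (s : 'S_n) (j : 'I_n) :
  lin_peaks (lift_perm (lift ord_max j) ord_max s) =
  (\sum_(k < n) (if k == j then true else if k.+1 == j then false else lin_peak s k))%N.
Proof.
set i := lift ord_max j; set r := lift_perm i ord_max s.
have iE : i = j :> nat := lift_max j.
have r_at : asc r j by rewrite -iE asc_insert_at.
have r_next : asc r j.+1 = false by rewrite -iE asc_insert_next // iE.
have r_before k : (k < j)%N -> asc r k = asc s k by rewrite -iE; apply: asc_insert_before.
have r_after k : (j < k <= n)%N -> asc r k.+1 = asc s k by rewrite -iE; apply: asc_insert_after.
have lt_j1 : (j.+1 < n.+1)%N by rewrite ltnS.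
rewrite /lin_peaks /npeaks (bigD1_ord (Ordinal lt_j1)) //= r_next add0n.
apply: eq_bigr => k _; rewrite -val_eqE /lin_peak /= /bump ltnNge.
case: (ltngtP k j) => [lt_kj|lt_jk|->] /=; last by rewrite r_at r_next.
  rewrite r_before //; case: (ltngtP k.+1 j) => [lt_k1j||eq_k1j] //.
  - by rewrite r_before.
  - by rewrite ltnNge lt_kj.
  by rewrite eq_k1j r_at andbF.
rewrite add1n !r_after ?lt_jk ?(ltnW (ltn_ord k)) //= ?ltn_ord ?andbT ?ltnS ?(ltnW lt_jk) //.
by rewrite gtn_eqF // ltnW.
Qed.

Lemma lin_peaks_recurrence : peak_recurrence lin_peaks.
Proof.
move=> V n F; rewrite (big_perm_insertion (ins := fun i s => lift_perm i ord_max s)) //; last first.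
- exact: lift_perm_max_inj.
- by move=> i s; rewrite lift_perm_id.
apply: eq_bigr => s _.
apply: (@sum_peak_insertion _ _ _ (fun k : 'I_n => lin_peak s k) (fun k => k.+1)) => //.
- by move=> j k [] /val_inj.
- move=> k /andP [_]; rewrite ltn_neqAle ltn_ord andbT.
  by apply: contraNneq => ->; apply: asc_last.
- by move=> j k /andP [_ desc_k] <-; rewrite /lin_peak (negbTE desc_k).
- exact: lin_peaks_insert_max.
- exact: lin_peaks_insert_lift.
Qed.

(** * Eulerian polynomials of type B *)

Section type_B_eulerian.
Variable R : comNzRingType.
Implicit Types p : {poly R}.

Definition eulerian_step (n : nat) p : {poly R} :=
  (n.*2.+1%:R * 'X + 1) * p + 2 * 'X * (1 - 'X) * p^`().

Fixpoint eulerianB (n : nat) : {poly R} :=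
  if n is m.+1 then eulerian_step m (eulerianB m) else 1.

Lemma natr_double n : n.*2%:R = 2 * n%:R :> R.
Proof. by rewrite -muln2 natrM mulrC. Qed.

Lemma natr_doubleS n : n.*2.+1%:R = 2 * n%:R + 1 :> R.
Proof. by rewrite -natr1 natr_double. Qed.

Lemma eulerian_step_sum (I : Type) (r : seq I) n (F : I -> {poly R}) :
  eulerian_step n (\sum_(i <- r) F i) = \sum_(i <- r) eulerian_step n (F i).
Proof. by rewrite /eulerian_step linear_sum !big_distrr -big_split. Qed.

Lemma mulX_deriv_exp (c : R) k :
  'X * ((c *: 'X) ^+ k)^`() = k%:R * (c *: 'X) ^+ k.
Proof.
rewrite exprZn derivZ derivXn -scalerAr mulrnAr -scalerMnr mulr_natl.
by case: k => [|k]; rewrite ?mulr0n // -exprS.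
Qed.

Lemma deriv_1addX_exp k : ((1 + 'X) ^+ k)^`() = k%:R * (1 + 'X) ^+ k.-1 :> {poly R}.
Proof. by rewrite deriv_exp derivD derivX derivC add0r mul1r mulr_natl. Qed.

Lemma eulerian_step_peaks k m :
  eulerian_step (m + k.*2) ((4 * 'X) ^+ k * (1 + 'X) ^+ m) =
  (4 * 'X) ^+ k * (1 + 'X) ^+ m.+1 *+ k.*2.+1 +
  (4 * 'X) ^+ k.+1 * (1 + 'X) ^+ m.-1 *+ m.
Proof.
have XD : 'X * ((4 * 'X) ^+ k)^`() = k%:R * (4 * 'X) ^+ k :> {poly R}.
  by rewrite -[4 * 'X]/(4%:R * 'X) mulr_natl -scaler_nat mulX_deriv_exp.
have mC : m%:R * (1 + 'X) ^+ m = (1 + 'X) * (m%:R * (1 + 'X) ^+ m.-1) :> {poly R}.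
  by case: m => [|m]; rewrite ?mul0r ?mulr0 // exprS mulrCA.
rewrite /eulerian_step derivM deriv_1addX_exp !exprS.
rewrite -[X in _ = X + _]mulr_natl -[X in _ = _ + X]mulr_natl.
have -> : (m + k.*2).*2.+1%:R = 2 * m%:R + 4 * k%:R + 1 :> {poly R}.
  by rewrite -natr1 -!muln2 !(natrD, natrM); ring.
have -> : k.*2.+1%:R = 2 * k%:R + 1 :> {poly R} by rewrite -natr1 -muln2 natrM mulrC.
move: ((4 * 'X) ^+ k) ((4 * 'X) ^+ k)^`() XD => Q Q' XD.
move: ((1 + 'X) ^+ m) ((1 + 'X) ^+ m.-1) mC => C C' mC.
have -> : 2 * 'X * (1 - 'X) * (Q' * C + Q * (m%:R * C')) =
  2 * (1 - 'X) * ('X * Q') * C + 2 * 'X * (1 - 'X) * Q * (m%:R * C') by ring.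
rewrite XD; move: m%:R k%:R mC => a b mC.
have -> : ((2 * a + 4 * b + 1) * 'X + 1) * (Q * C) =
  2 * 'X * Q * (a * C) + ((4 * b + 1) * 'X + 1) * (Q * C) by ring.
by rewrite mC; ring.
Qed.

Definition peak_sum n (pk : 'S_n -> nat) : {poly R} :=
  \sum_s (4 * 'X) ^+ pk s * (1 + 'X) ^+ (n - (pk s).*2).

Lemma peak_sum_eulerianB (pk : forall n, 'S_n -> nat) :
  peak_recurrence pk -> (forall n (s : 'S_n), (pk n s).*2 <= n)%N ->
  forall n, peak_sum (@pk n) = eulerianB n.
Proof.
move=> pk_rec pk_le; elim=> [|n IHn]; rewrite /peak_sum.
  rewrite (eq_bigr (fun=> 1)) ?sumr_const ?card_Sn // => s _.
  by have := pk_le _ s; case: (pk 0%N s) => // _; rewrite expr0 mul1r.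
rewrite (pk_rec _ n (fun k => (4 * 'X : {poly R}) ^+ k * (1 + 'X) ^+ (n.+1 - k.*2))).
rewrite /= -IHn /peak_sum eulerian_step_sum; apply: eq_bigr => s _.
have := pk_le _ s; move: (pk n s) => k le_k.
have := eulerian_step_peaks k (n - k.*2); rewrite subnK // => ->.
by rewrite subSn // doubleS subSS subnS.
Qed.

Lemma sum_exc_B n : \sum_(pi in signed_perms n) 'X^(exc_B pi) = eulerianB n.
Proof.
rewrite (sum_signed_perms_npeaks _ (@exc_B_separable n) (@anti_exc_balanced n)).
apply: (@peak_sum_eulerianB cyc_peaks cyc_peaks_recurrence) => m s.
exact/double_npeaks_le/anti_exc_balanced.
Qed.

Lemma sum_des_B n : \sum_(pi in signed_perms n) 'X^(des_B pi) = eulerianB n.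
Proof.
rewrite (sum_signed_perms_npeaks _ (@des_B_separable n) (@asc_balanced n)).
apply: (@peak_sum_eulerianB lin_peaks lin_peaks_recurrence) => m s.
exact/double_npeaks_le/asc_balanced.
Qed.

Lemma alternating_sum_exc_B n :
  \sum_(pi in signed_perms n) (-1) ^+ inv_B pi * 'X^(exc_B pi) = (1 - 'X) ^+ n :> {poly R}.
Proof.
apply: (alternating_sum_signed_perms _ (@exc_B_separable n)); first exact: anti_exc_shift_id.
  by move=> j; rewrite /anti_exc !perm1 leqnn.
by move=> j; rewrite /anti_exc !perm1 leqnn.
Qed.

Lemma alternating_sum_des_B n :
  \sum_(pi in signed_perms n) (-1) ^+ inv_B pi * 'X^(des_B pi) = (1 - 'X) ^+ n :> {poly R}.
Proof.
apply: (alternating_sum_signed_perms _ (@des_B_separable n)); first exact: asc_shift_id.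
  by move=> j; apply/asc1/ltnW.
by move=> j; apply: asc1.
Qed.

Lemma eulerian_step_horner1 n p : (eulerian_step n p).[1] = n.+1.*2%:R * p.[1].
Proof.
rewrite /eulerian_step !(hornerD, hornerM, hornerN, hornerMn, hornerX, hornerC).
by rewrite natr_doubleS natr_double -natr1; ring.
Qed.

Lemma deriv_eulerian_step_horner1 n p :
  (eulerian_step n p)^`().[1] = n.*2.+1%:R * p.[1] + n.*2%:R * p^`().[1].
Proof.
rewrite /eulerian_step !(derivD, derivM, derivN, derivMn, derivX, derivC, deriv0).
rewrite !(hornerD, hornerM, hornerN, hornerMn, hornerX, hornerC, horner0) ?natr_doubleS.
by rewrite ?natr_double; ring.
Qed.

Lemma deriv2_eulerian_step_horner1 n p :
  (eulerian_step n p)^`()^`().[1] =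
  (4 * n%:R - 2) * p^`().[1] + (2 * n%:R - 2) * p^`()^`().[1].
Proof.
rewrite /eulerian_step !(derivD, derivM, derivN, derivMn, derivX, derivC, deriv0).
rewrite !(hornerD, hornerM, hornerN, hornerMn, hornerX, hornerC, horner0) ?natr_doubleS.
by rewrite ?natr_double; ring.
Qed.

Lemma eulerianB_horner1 n : (eulerianB n).[1] = (2 ^ n * n`!)%:R.
Proof.
elim: n => [|n IHn] /=; first by rewrite hornerE.
by rewrite eulerian_step_horner1 IHn -natrM factS expnS -muln2; congr _%:R; ring.
Qed.

Lemma eulerianB_horner0 n : (eulerianB n).[0] = 1.
Proof.
elim: n => [|n IHn] /=; first by rewrite hornerE.
rewrite /eulerian_step !(hornerD, hornerM, hornerN, hornerX, hornerC) IHn.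
by rewrite !(mulr0, mul0r) add0r mul1r addr0.
Qed.

Lemma coef_eulerian_step n p k :
  (eulerian_step n p)`_k.+1 =
  (2 * k%:R + 3) * p`_k.+1 + (2 * n%:R - 2 * k%:R + 1) * p`_k.
Proof.
have -> : eulerian_step n p =
  n.*2.+1%:R *: ('X * p) + p + 2 *: ('X * p^`()) - 2 *: ('X * ('X * p^`())).
  by rewrite /eulerian_step -!mul_polyC !polyC_natr; ring.
rewrite !(coefD, coefN, coefZ, coefXM) /= !coef_deriv natr_doubleS.
case: k => [|k] /=; first by rewrite -mulr_natl; ring.
by rewrite -[_ *+ k.+2]mulr_natl -[_ *+ k.+1]mulr_natl -[k.+2%:R]natr1; ring.
Qed.

Lemma size_monic_eulerianB n : size (eulerianB n) = n.+1 /\ eulerianB n \is monic.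
Proof.
elim: n => [|n [size_n monic_n]]; first by rewrite size_poly1 monic1.
have lead_n : (eulerianB n)`_n = 1 by move/monicP: monic_n; rewrite lead_coefE size_n.
have lead_nS : (eulerianB n.+1)`_n.+1 = 1.
  by rewrite coef_eulerian_step lead_n nth_default ?size_n // mulr0 add0r mulr1 subrr add0r.
have size_nS : size (eulerianB n.+1) = n.+2.
  apply/eqP; rewrite eqn_leq; apply/andP; split.
    apply/leq_sizeP => -[|k] // lt_nk; rewrite coef_eulerian_step.
    by rewrite !nth_default ?mulr0 ?addr0 // size_n // ltnW.
  rewrite ltnNge; apply/negP => /leq_sizeP /(_ _ (leqnn _)).
  by rewrite lead_nS; apply/eqP/oner_neq0.
by rewrite monicE lead_coefE size_nS lead_nS.
Qed.

End type_B_eulerian.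

Section eulerianB_moments.
Variable R : numFieldType.
Local Notation B := (eulerianB R).

Lemma eulerianB_horner1_gt0 n : 0 < (B n).[1].
Proof. by rewrite eulerianB_horner1 ltr0n muln_gt0 expn_gt0 fact_gt0. Qed.

Lemma deriv_eulerianB_horner1 n : (B n)^`().[1] = n%:R / 2 * (B n).[1].
Proof.
elim: n => [|n IHn] /=; first by rewrite derivC hornerE !mul0r.
rewrite deriv_eulerian_step_horner1 eulerian_step_horner1 IHn natr_doubleS !natr_double -natr1.
by field.
Qed.

Lemma deriv2_eulerianB_horner1 n : (2 <= n)%N ->
  (B n)^`()^`().[1] = (3 * n%:R ^+ 2 - 5 * n%:R + 1) / 12 * (B n).[1].
Proof.
case: n => [|[|n]] // _; elim: n => [|n IHn].
  rewrite [B 2]/= deriv2_eulerian_step_horner1 eulerian_step_horner1 (deriv_eulerianB_horner1 1).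
  by rewrite natr_double; field.
have -> : B n.+3 = eulerian_step n.+2 (B n.+2) by [].
rewrite deriv2_eulerian_step_horner1 eulerian_step_horner1 IHn deriv_eulerianB_horner1.
by rewrite natr_double -[n.+3%:R]natr1; field.
Qed.

End eulerianB_moments.

(** * Real roots *)

Definition nonpos_rooted (R : numDomainType) (p : {poly R}) : Prop :=
  exists2 rs : seq R, all (<= 0) rs & p = lead_coef p *: \prod_(r <- rs) ('X - r%:P).

Section real_roots.
Variable R : rcfType.
Implicit Types (p : {poly R}) (x y z : nat -> R).

Definition decreasing_below n x : Prop := {in gtn n &, {mono x : i j /~ (i <= j)%O}}.

Lemma decreasing_belowP n x :
  (forall i, (i.+1 < n)%N -> x i.+1 < x i) -> decreasing_below n x.
Proof.
move=> x_decr; apply: Order.NatMonotonyTheory.decn_inP => [i j|i _]; last exact: x_decr.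
by move=> _ lt_jn k /andP [_ /ltn_trans]; apply.
Qed.

Lemma decreasing_below_lt n x i j : decreasing_below n x -> (i < j < n)%N -> x j < x i.
Proof.
move=> /leW_nmono_in x_decr /andP [lt_ij lt_jn].
by rewrite x_decr ?inE // (ltn_trans lt_ij).
Qed.

Lemma root_of_alternating_signs p i a b :
  a < b -> 0 < (-1) ^+ i * p.[b] -> 0 < (-1) ^+ i.+1 * p.[a] ->
  exists2 w, a < w < b & root p w.
Proof.
move=> lt_ab sign_b sign_a.
have [||w] := @poly_ivtoo _ p a b; first exact: ltW.
  have := mulr_gt0 sign_a sign_b.
  rewrite mulrACA -exprD addSn addnn exprS -mul2n exprM sqrrN !expr1n mulr1 mulN1r.
  by rewrite oppr_gt0.
by rewrite in_itv; exists w.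
Qed.

Lemma roots_of_alternating_signs n p z :
  p \is monic -> size p = n.+1 -> decreasing_below n.+1 z ->
  (forall i, (i <= n)%N -> 0 < (-1) ^+ i * p.[z i]) ->
  exists y, [/\ forall i, (i < n)%N -> z i.+1 < y i < z i, decreasing_below n y &
    p = \prod_(i < n) ('X - (y i)%:P)].
Proof.
move=> p_monic size_p z_decr sign.
have /choice[y yP] i : exists w, (i < n)%N -> (z i.+1 < w < z i) /\ root p w.
  have [lt_in|_] := ltnP i n; last by exists 0.
  have [|w] := root_of_alternating_signs _ (sign i (ltnW lt_in)) (sign i.+1 lt_in).
    by rewrite (decreasing_below_lt z_decr) // ltnSn.
  by exists w.
have y_decr : decreasing_below n y.
  apply: decreasing_belowP => i lt_in.
  have /yP[/andP[_ lt_y] _] := lt_in; have /yP[/andP[gt_y _] _] := ltnW lt_in.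
  exact: lt_trans lt_y gt_y.
have y_inj : {in iota 0 n &, injective y}.
  by move=> i j; rewrite !mem_iota; apply: (dec_inj_in y_decr).
exists y; split=> // [i /yP[]//|].
have := @all_roots_prod_XsubC _ p [seq y i | i <- iota 0 n].
rewrite size_map size_iota size_p (monicP p_monic) scale1r big_map uniq_rootsE.
rewrite map_inj_in_uniq // iota_uniq => /(_ erefl _ isT) ->; last first.
  by apply/allP => _ /mapP [i + ->]; rewrite mem_iota => /andP [_ /yP[]].
by rewrite -[X in iota 0 X]subn0 -/(index_iota 0 n) big_mkord.
Qed.

Lemma sign_deriv_prod_XsubC n x (i : 'I_n) : decreasing_below n x ->
  0 < (-1) ^+ i * (\prod_(j < n) ('X - (x j)%:P))^`().[x i].
Proof.
move=> x_decr.
have -> : (\prod_(j < n) ('X - (x j)%:P))^`().[x i] = \prod_(j < n | j != i) (x i - x j).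
  rewrite (bigD1 i) //= derivM derivXsubC mul1r hornerD hornerM hornerXsubC subrr mul0r.
  by rewrite addr0 horner_prod; apply: eq_bigr => j _; rewrite hornerXsubC.
have sum_before : (\sum_(j < n | j != i) (j < i) = i)%N.
  transitivity (\sum_(j < n | (j < i)%N) 1)%N.
    rewrite big_mkcond [RHS]big_mkcond; apply: eq_bigr => j _.
    by rewrite -val_eqE /=; case: ltngtP.
  by rewrite -(big_ord_widen _ (fun=> 1%N)) ?sum1_card ?card_ord // ltnW.
rewrite -{1}sum_before expr_sum -big_split /=; apply: prodr_gt0 => j neq_ji.
have [lt_ji|] := ltnP j i.
  by rewrite mulN1r opprB subr_gt0 (decreasing_below_lt x_decr) ?lt_ji /=.
rewrite leq_eqVlt eq_sym val_eqE (negPf neq_ji) /= => lt_ij.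
by rewrite mul1r subr_gt0 (decreasing_below_lt x_decr) ?lt_ij /=.
Qed.

Lemma monic_sign_minfty p : p \is monic ->
  exists M : R, forall t, t <= M -> 0 < (-1) ^+ (size p).-1 * p.[t].
Proof.
move=> p_monic; exists (- cauchy_bound p) => t le_t.
have /(_ t) := sgp_minftyP (le_cauchy_bound (monic_neq0 p_monic)).
rewrite in_itv => /(_ le_t); rewrite /sgp_minfty (monicP p_monic) mulr1 => sg_p.
by rewrite -sgr_gt0 sgrM sg_p -expr2 sqr_sg signr_eq0.
Qed.

Lemma eulerian_step_sign_root n m x (i : 'I_n) :
  decreasing_below n x -> x i < 0 ->
  0 < (-1) ^+ i.+1 * (eulerian_step m (\prod_(j < n) ('X - (x j)%:P))).[x i].
Proof.
move=> /(sign_deriv_prod_XsubC i); set b := (_^`()).[x i] => sign_b xi_lt0.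
have root_i : (\prod_(j < n) ('X - (x j)%:P)).[x i] = 0.
  by rewrite horner_prod (bigD1 i) //= hornerXsubC subrr mul0r.
rewrite /eulerian_step hornerD hornerM root_i mulr0 add0r.
rewrite !(hornerM, hornerD, hornerN, hornerX, hornerC) -/b exprS.
rewrite (_ : _ * _ = 2 * (- x i * (1 - x i)) * ((-1) ^+ i * b)); last by ring.
by do 2!apply: mulr_gt0 => //; apply: mulr_gt0; lra.
Qed.

(* The values of [B_(n+1)] alternate in sign along 0, the roots of [B_n] and
   minus infinity. *)
Lemma eulerianB_simple_neg_roots n : exists x,
  [/\ forall i, (i < n)%N -> x i < 0, decreasing_below n x &
    eulerianB R n = \prod_(i < n) ('X - (x i)%:P)].
Proof.
elim: n => [|n [x [x_lt0 x_decr Bn]]].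
  by exists (fun=> 0); split=> //; rewrite big_ord0.
have [size_Bn1 monic_Bn1] := size_monic_eulerianB R n.+1.
have [M signM] := monic_sign_minfty monic_Bn1; rewrite size_Bn1 in signM.
pose w i := if i is j.+1 then x j else 0.
pose z i := if (i <= n)%N then w i else Num.min M (w n - 1).
have z_decr : decreasing_below n.+2 z.
  apply: decreasing_belowP => i; rewrite !ltnS leq_eqVlt /z => /orP [/eqP ->|lt_in].
    by rewrite ltnn leqnn gt_min ltrBlDr ltrDl ltr01 orbT.
  rewrite lt_in ltnW //; case: i lt_in => [|i] lt_in; first exact: x_lt0.
  by apply: (decreasing_below_lt x_decr); rewrite ltnSn.
have [i|y [y_itv y_decr Bn1]] := roots_of_alternating_signs monic_Bn1 size_Bn1 z_decr.
  rewrite leq_eqVlt /z => /orP [/eqP ->|]; first by rewrite ltnn signM // ge_min lexx.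
  rewrite ltnS => le_in; rewrite le_in; case: i le_in => [|i] lt_in.
    by rewrite mul1r eulerianB_horner0.
  rewrite /= Bn; apply: (@eulerian_step_sign_root n n x (Ordinal lt_in)) => //.
  exact: x_lt0.
exists y; split=> // i lt_in; have /andP [_ lt_y] := y_itv i lt_in.
apply: lt_le_trans lt_y _; case: i lt_in => // i lt_in.
by apply: ltW (decreasing_below_lt (i := 0%N) z_decr _); rewrite /= ltnW.
Qed.

Lemma eulerianB_nonpos_rooted n : nonpos_rooted (eulerianB R n).
Proof.
have [x [x_lt0 _ Bn]] := eulerianB_simple_neg_roots n.
exists [seq x i | i <- iota 0 n].
  by apply/allP => _ /mapP [i + ->]; rewrite mem_iota => /andP [_ /x_lt0 /ltW].
have [_ /monicP ->] := size_monic_eulerianB R n.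
by rewrite scale1r Bn big_map -[X in iota 0 X]subn0 -/(index_iota 0 n) big_mkord.
Qed.

End real_roots.

(** * Coefficient distributions *)

Section coefficient_sums.
Variable R : comNzRingType.
Implicit Types (p : {poly R}) (f g : nat -> R).

Definition coef_pairing f p : R := \sum_(k < size p) f k * p`_k.

Lemma coef_pairing_widen n f p : (size p <= n)%N -> coef_pairing f p = \sum_(k < n) f k * p`_k.
Proof.
move=> le_n; rewrite /coef_pairing (big_ord_widen n (fun k => f k * p`_k) le_n) big_mkcond /=.
by apply: eq_bigr => k _; case: ltnP => // le_k; rewrite nth_default // mulr0.
Qed.

Fact coef_pairing_is_linear f : linear_for *%R (coef_pairing f).
Proof.
move=> c p q; pose n := maxn (size (c *: p + q)) (maxn (size p) (size q)).
rewrite !(@coef_pairing_widen n) ?leq_max ?leqnn ?orbT // big_distrr -big_split /=.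
by apply: eq_bigr => k _; rewrite coefD coefZ; ring.
Qed.

HB.instance Definition _ f :=
  GRing.isLinear.Build R {poly R} R *%R (coef_pairing f) (coef_pairing_is_linear f).

Lemma eq_coef_pairing f g : f =1 g -> coef_pairing f =1 coef_pairing g.
Proof. by move=> fg p; apply: eq_bigr => k _; rewrite fg. Qed.

Lemma coef_pairing0f p : coef_pairing (fun=> 0) p = 0.
Proof. by apply: big1 => k _; rewrite mul0r. Qed.

Lemma coef_pairing_addf f g p :
  coef_pairing (fun k => f k + g k) p = coef_pairing f p + coef_pairing g p.
Proof. by rewrite -big_split; apply: eq_bigr => k _; rewrite mulrDl. Qed.

Lemma coef_pairing_scalef c f p : coef_pairing (fun k => c * f k) p = c * coef_pairing f p.
Proof. by rewrite big_distrr; apply: eq_bigr => k _; rewrite /= mulrA. Qed.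

Lemma coef_pairing1 p : coef_pairing (fun=> 1) p = p.[1].
Proof. by rewrite horner_coef; apply: eq_bigr => k _; rewrite expr1n mulrC. Qed.

Lemma coef_pairingXn f k : coef_pairing f 'X^k = f k.
Proof.
rewrite /coef_pairing size_polyXn (bigD1 ord_max) //= coefXn eqxx mulr1 big1 ?addr0 // => i.
by rewrite coefXn -val_eqE => /negbTE ->; rewrite mulr0.
Qed.

Lemma coef_pairing_mulX f p : coef_pairing f ('X * p) = coef_pairing (f \o succn) p.
Proof.
rewrite -[in LHS](coefK p) poly_def big_distrr linear_sum; apply: eq_bigr => k _.
by rewrite /= -scalerAr -exprS linearZ /= coef_pairingXn mulrC.
Qed.

Lemma coef_pairing_deriv f p : coef_pairing f p^`() = coef_pairing (fun k => k%:R * f k.-1) p.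
Proof.
rewrite -[in LHS](coefK p) poly_def !linear_sum; apply: eq_bigr => k _.
by rewrite /= derivZ derivXn linearZ linearMn /= coef_pairingXn mulr_natl mulrC.
Qed.

Lemma coef_pairing_id p : coef_pairing (fun k => k%:R) p = p^`().[1].
Proof.
by rewrite -coef_pairing1 coef_pairing_deriv; apply: eq_coef_pairing => k; rewrite mulr1.
Qed.

Lemma coef_pairing_sqr p : coef_pairing (fun k => k%:R ^+ 2) p = p^`()^`().[1] + p^`().[1].
Proof.
rewrite -coef_pairing_id coef_pairing_deriv -coef_pairing_id -coef_pairing_addf.
by apply: eq_coef_pairing; case=> [|k] /=; rewrite -?natr1; ring.
Qed.

End coefficient_sums.

Lemma le_coef_pairing (R : numDomainType) (p : {poly R}) (f g : nat -> R) :
  (forall k, 0 <= p`_k) -> (forall k, f k <= g k) -> coef_pairing f p <= coef_pairing g p.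
Proof. by move=> p_ge0 le_fg; apply: ler_sum => k _; apply: ler_wpM2r. Qed.

Section coefficient_expectation.
Variable R : realType.
Implicit Types (p : {poly R}) (f g : nat -> R).

Definition coef_expect p f : R := coef_pairing f p / p.[1].

Lemma eq_coef_expect p f g : f =1 g -> coef_expect p f = coef_expect p g.
Proof. by move=> /eq_coef_pairing fg; rewrite /coef_expect fg. Qed.

Lemma coef_expect_addf p f g :
  coef_expect p (fun k => f k + g k) = coef_expect p f + coef_expect p g.
Proof. by rewrite /coef_expect coef_pairing_addf mulrDl. Qed.

Lemma coef_meanE p : coef_mean p = coef_expect p (fun k => k%:R).
Proof. by rewrite /coef_mean /coef_expect big_distrl; apply: eq_bigr => k _; rewrite mulrA. Qed.

Lemma coef_varE p : coef_var p = coef_expect p (fun k => (k%:R - coef_mean p) ^+ 2).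
Proof. by rewrite /coef_var /coef_expect big_distrl; apply: eq_bigr => k _; rewrite mulrA. Qed.

Lemma coef_mean_deriv p : coef_mean p = p^`().[1] / p.[1].
Proof. by rewrite coef_meanE /coef_expect coef_pairing_id. Qed.

Lemma coef_var_deriv p : p.[1] != 0 ->
  coef_var p = (p^`()^`().[1] + p^`().[1]) / p.[1] - (p^`().[1] / p.[1]) ^+ 2.
Proof.
move=> p1_neq0; rewrite coef_varE coef_mean_deriv /coef_expect; set m := p^`().[1] / p.[1].
rewrite (@eq_coef_pairing _ _ (fun k => k%:R ^+ 2 + (- (2 * m) * k%:R + m ^+ 2 * 1))); last first.
  by move=> k; ring.
rewrite !(coef_pairing_addf, coef_pairing_scalef) coef_pairing_sqr coef_pairing_id coef_pairing1 /m.
by field.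
Qed.

Section probability.
Variable p : {poly R}.
Hypothesis p_distr : has_coef_distr p.

Let p_ge0 : forall k, 0 <= p`_k := proj1 p_distr.
Let p1_gt0 : 0 < p.[1] := proj2 p_distr.

Lemma le_coef_expect f g : (forall k, f k <= g k) -> coef_expect p f <= coef_expect p g.
Proof. by move=> le_fg; rewrite ler_pM2r ?invr_gt0 //; apply: le_coef_pairing. Qed.

Lemma coef_expect_cst (c : R) : coef_expect p (fun=> c) = c.
Proof.
rewrite /coef_expect (@eq_coef_pairing _ _ (fun=> c * 1)); last by move=> k; rewrite mulr1.
by rewrite coef_pairing_scalef coef_pairing1 mulfK // gt_eqF.
Qed.

Lemma coef_expect_bounds f (a b : R) :
  (forall k, a <= f k <= b) -> a <= coef_expect p f <= b.
Proof.
move=> f_ab; rewrite -(coef_expect_cst a) -(coef_expect_cst b).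
by rewrite !le_coef_expect // => k; case/andP: (f_ab k).
Qed.

End probability.

Definition coef_std p (k : nat) : R := (k%:R - coef_mean p) / Num.sqrt (coef_var p).

Definition coef_cdf p (x : R) : R :=
  coef_expect p (fun k => (k%:R <= x * Num.sqrt (coef_var p) + coef_mean p)%R%:R).

Lemma coef_cdfE p x :
  \sum_(k < size p | k%:Z <= Num.floor (x * Num.sqrt (coef_var p) + coef_mean p))
    coef_prob p k = coef_cdf p x.
Proof.
rewrite /coef_cdf /coef_expect /coef_pairing big_distrl big_mkcond; apply: eq_bigr => k _ /=.
by rewrite floor_ge_int -pmulrn /coef_prob; case: ifP => _; rewrite ?mul1r // !mul0r.
Qed.

Lemma coef_cdf_std p x : 0 < coef_var p ->
  coef_cdf p x = coef_expect p (fun k => (coef_std p k <= x)%R%:R).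
Proof.
by move=> var_gt0; apply: eq_coef_expect => k; rewrite ler_pdivrMr ?sqrtr_gt0 // lerBlDr.
Qed.

Lemma coef_cdf_nondecreasing p : has_coef_distr p -> {homo coef_cdf p : x y / x <= y}.
Proof.
move=> p_distr x y le_xy; apply: le_coef_expect => // k.
case: (Order.TotalTheory.leP k%:R) => //= le_k.
by rewrite (le_trans le_k) // lerD2r ler_wpM2r.
Qed.

Lemma coef_cdf_itv01 p x : has_coef_distr p -> 0 <= coef_cdf p x <= 1.
Proof. by move=> p_distr; apply: coef_expect_bounds => // k; rewrite ler0n lern1 leq_b1. Qed.

End coefficient_expectation.

Section statistic_polynomial.
Variables (R : realType) (T : finType) (S : {set T}) (stat : T -> nat).
Local Notation p := (stat_poly R S stat).

Lemma coef_pairing_stat_poly (f : nat -> R) : coef_pairing f p = \sum_(x in S) f (stat x).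
Proof. by rewrite linear_sum; apply: eq_bigr => x _; rewrite /= coef_pairingXn. Qed.

Lemma stat_poly_horner1 : p.[1] = #|S|%:R.
Proof. by rewrite -coef_pairing1 coef_pairing_stat_poly sumr_const. Qed.

Lemma stat_poly_coef_ge0 k : 0 <= p`_k.
Proof. by rewrite coef_sum sumr_ge0 // => x _; rewrite coefXn ler0n. Qed.

Lemma unif_mean_stat_poly : unif_mean R S stat = coef_mean p.
Proof. by rewrite coef_meanE /coef_expect coef_pairing_stat_poly stat_poly_horner1. Qed.

Lemma unif_var_stat_poly : unif_var R S stat = coef_var p.
Proof.
by rewrite coef_varE /coef_expect coef_pairing_stat_poly stat_poly_horner1 -unif_mean_stat_poly.
Qed.

End statistic_polynomial.

(** * Sums of independent Bernoulli variables *)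

Section poisson_binomial.
Variable R : realFieldType.
Implicit Types (a : R) (ps : seq R) (f g : nat -> R).

Definition bernoulli_pgf a : {poly R} := (1 - a)%:P + a *: 'X.
Definition poisson_binomial ps : {poly R} := \prod_(a <- ps) bernoulli_pgf a.
Definition bernoulli_params ps : bool := all (fun a => 0 <= a <= 1) ps.
Definition pb_mean ps : R := \sum_(a <- ps) a.
Definition pb_var ps : R := \sum_(a <- ps) a * (1 - a).

Definition bernoulli_avg a f (k : nat) : R := (1 - a) * f k + a * f k.+1.

Lemma coef_pairing_poisson_binomial_cons f a ps :
  coef_pairing f (poisson_binomial (a :: ps)) =
  coef_pairing (bernoulli_avg a f) (poisson_binomial ps).
Proof.
rewrite /poisson_binomial big_cons mulrDl mul_polyC -scalerAl linearD !linearZ /=.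
by rewrite coef_pairing_mulX coef_pairing_addf !coef_pairing_scalef.
Qed.

Lemma norm_convex_comb_le a (u v K : R) : 0 <= a <= 1 ->
  `|u| <= K -> `|v| <= K -> `|(1 - a) * u + a * v| <= K.
Proof.
case/andP=> a_ge0; rewrite -subr_ge0 => b_ge0 u_le v_le.
apply: le_trans (ler_normD _ _) _; rewrite !normrM (ger0_norm a_ge0) (ger0_norm b_ge0).
by apply: le_trans (lerD (ler_wpM2l b_ge0 u_le) (ler_wpM2l a_ge0 v_le)) _; lra.
Qed.

Lemma poisson_binomial_horner1 ps : (poisson_binomial ps).[1] = 1.
Proof.
rewrite /poisson_binomial horner_prod big1 // => a _.
by rewrite hornerD hornerC hornerZ hornerX mulr1 subrK.
Qed.

Lemma poisson_binomial_coef_ge0 ps :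
  bernoulli_params ps -> forall k, 0 <= (poisson_binomial ps)`_k.
Proof.
elim: ps => [_ k|a ps IHps /= /andP [/andP [a_ge0 a_le1] /IHps {}IHps] k].
  by rewrite /poisson_binomial big_nil coef1 ler0n.
rewrite /poisson_binomial big_cons mulrDl mul_polyC -scalerAl coefD !coefZ coefXM.
by rewrite addr_ge0 // mulr_ge0 ?subr_ge0 //; case: k.
Qed.

Lemma norm_poisson_binomial_le ps f (K : R) : bernoulli_params ps ->
  (forall k, `|f k| <= K) -> `|coef_pairing f (poisson_binomial ps)| <= K.
Proof.
move=> ps01 f_le; apply: le_trans (ler_norm_sum _ _ _) _.
rewrite -[leRHS]mulr1 -(poisson_binomial_horner1 ps) -coef_pairing1 -coef_pairing_scalef.
apply: ler_sum => k _; have coef_ge0 := poisson_binomial_coef_ge0 ps01 k.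
by rewrite normrM mulr1 (ger0_norm coef_ge0) ler_wpM2r.
Qed.

(* It vanishes when [f] is affine and [g] is its slope. *)
Definition stein_discrepancy ps f g : R :=
  coef_pairing (fun k => (k%:R - pb_mean ps) * f k) (poisson_binomial ps) -
  pb_var ps * coef_pairing g (poisson_binomial ps).

Lemma stein_discrepancy_cons a ps f g :
  stein_discrepancy (a :: ps) f g =
  stein_discrepancy ps (bernoulli_avg a f) (bernoulli_avg a g) +
  a * (1 - a) *
    coef_pairing (fun k => f k.+1 - f k - bernoulli_avg a g k) (poisson_binomial ps).
Proof.
rewrite /stein_discrepancy !coef_pairing_poisson_binomial_cons /pb_mean /pb_var !big_cons.
rewrite -/(pb_mean ps) -/(pb_var ps); set d := fun k => f k.+1 - f k - _.
rewrite (@eq_coef_pairing _ (bernoulli_avg a (fun k => _ * f k))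
  (fun k => (k%:R - pb_mean ps) * bernoulli_avg a f k +
            a * (1 - a) * (bernoulli_avg a g k + d k))).
  by rewrite !(coef_pairing_addf, coef_pairing_scalef); ring.
by move=> k; rewrite /d /bernoulli_avg -natr1; ring.
Qed.

(* By induction on the number of variables: adding one averages [f] and [g] over
   it, which preserves the hypothesis. *)
Lemma poisson_binomial_stein ps f g (K : R) : bernoulli_params ps ->
  (forall k j, (k <= j <= k.+1)%N -> `|f k.+1 - f k - g j| <= K) ->
  `|stein_discrepancy ps f g| <= K * pb_var ps.
Proof.
elim: ps f g => [|a ps IHps] f g.
  move=> _ _; rewrite /stein_discrepancy /pb_var /pb_mean !big_nil mulr0 mul0r subr0.
  by rewrite /coef_pairing /poisson_binomial big_nil size_poly1 big_ord1 subr0 !mul0r normr0.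
case/andP=> a01 ps01 fg_le; have /andP [a_ge0 a_le1] := a01.
have aa_ge0 : 0 <= a * (1 - a) by rewrite mulr_ge0 ?subr_ge0.
rewrite stein_discrepancy_cons /pb_var big_cons addrC [K * _]mulrDr.
apply: le_trans (ler_normD _ _) (lerD _ _).
  rewrite normrM (ger0_norm aa_ge0) mulrC ler_wpM2r // norm_poisson_binomial_le // => k.
  rewrite (_ : _ - _ = (1 - a) * (f k.+1 - f k - g k) + a * (f k.+1 - f k - g k.+1)).
    by apply: norm_convex_comb_le => //; apply: fg_le; rewrite ?leqnn ?leqnSn.
  by rewrite /bernoulli_avg; ring.
apply: IHps => // k j le_kj.
rewrite (_ : _ - _ - _ =
  (1 - a) * (f k.+1 - f k - g j) + a * (f k.+2 - f k.+1 - g j.+1)).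
  by apply: norm_convex_comb_le => //; apply: fg_le; rewrite ?ltnS.
by rewrite /bernoulli_avg; ring.
Qed.

Lemma poisson_binomial_centered ps : bernoulli_params ps ->
  coef_pairing (fun k => k%:R - pb_mean ps) (poisson_binomial ps) = 0.
Proof.
move=> ps01; have : `|stein_discrepancy ps (fun=> 1) (fun=> 0)| <= 0 * pb_var ps.
  by apply: poisson_binomial_stein => // k j _; rewrite subr0 subrr normr0.
rewrite /stein_discrepancy coef_pairing0f mulr0 subr0 mul0r normr_le0 => /eqP <-.
by apply: eq_coef_pairing => k; rewrite mulr1.
Qed.

Lemma poisson_binomial_var ps : bernoulli_params ps ->
  coef_pairing (fun k => (k%:R - pb_mean ps) ^+ 2) (poisson_binomial ps) = pb_var ps.
Proof.
move=> ps01.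
have : `|stein_discrepancy ps (fun k => k%:R - pb_mean ps) (fun=> 1)| <= 0 * pb_var ps.
  apply: poisson_binomial_stein => // k j _.
  by rewrite -natr1 (_ : _ - _ - _ = 0) ?normr0 //; ring.
rewrite /stein_discrepancy coef_pairing1 poisson_binomial_horner1 mulr1 mul0r.
by rewrite normr_le0 subr_eq0 => /eqP <-.
Qed.

End poisson_binomial.

(** * Mean value inequalities *)

Lemma lipschitz_continuous (K : realFieldType) (V W : normedModType K) (f : V -> W) (L : K) :
  L.-lipschitz f -> continuous f.
Proof.
move=> lip x; apply/cvgrPdist_lt => e e_gt0.
have L1_gt0 : 0 < `|L| + 1 by rewrite ltr_pwDr.
near=> t; apply: le_lt_trans (lip (x, t) (conj I I)) _ => /=.
have : `|x - t| < e / (`|L| + 1) by near: t; apply: cvgr_dist_lt => //; apply: divr_gt0.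
by rewrite ltr_pdivlMr //; have := normr_ge0 (x - t); have := ler_norm L; nra.
Unshelve. all: by end_near. Qed.

Section derivatives.
Variable R : realType.
Implicit Types f df : R -> R.

Lemma is_derive_continuous f df : (forall x : R, is_derive x 1 f (df x)) -> continuous f.
Proof. by move=> f_df x; apply/differentiable_continuous/derivable1_diffP; case: (f_df x). Qed.

Lemma is_derive_MVT f df a b : (forall x : R, is_derive x 1 f (df x)) -> a < b ->
  exists2 c, a < c < b & f b - f a = df c * (b - a).
Proof.
move=> f_df lt_ab; have [|c c_in eq_c] := @MVT R f df a b lt_ab (fun x _ => f_df x).
  by apply: continuous_subspaceT; apply: is_derive_continuous f_df.
by exists c => //; move: c_in; rewrite in_itv.
Qed.

Lemma is_derive_ge0_le f df a b : (forall x : R, is_derive x 1 f (df x)) ->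
  (forall x, a < x < b -> 0 <= df x) -> a <= b -> f a <= f b.
Proof.
move=> f_df df_ge0; rewrite le_eqVlt => /orP [/eqP -> //|lt_ab].
have [c c_in eq_c] := is_derive_MVT f_df lt_ab.
by rewrite -subr_ge0 eq_c mulr_ge0 ?df_ge0 // subr_ge0 ltW.
Qed.

Lemma is_derive_le0_ge f df a b : (forall x : R, is_derive x 1 f (df x)) ->
  (forall x, a < x < b -> df x <= 0) -> a <= b -> f b <= f a.
Proof.
move=> f_df df_le0 le_ab; rewrite -lerN2.
apply: (@is_derive_ge0_le (fun x => - f x) (fun x => - df x)) => // x /df_le0.
by rewrite oppr_ge0.
Qed.

Lemma is_derive_lipschitz f df (L : R) : (forall x : R, is_derive x 1 f (df x)) ->
  (forall x, `|df x| <= L) -> L.-lipschitz f.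
Proof.
move=> f_df df_le [x y] _ /=; wlog lt_xy : x y / x < y => [wlg|].
  have [->|] := eqVneq x y; first by rewrite !subrr normr0 mulr0.
  rewrite neq_lt => /orP [lt_xy|lt_yx]; first exact: wlg.
  by rewrite (distrC (f x)) (distrC x); apply: wlg.
have [c _ eq_c] := is_derive_MVT f_df lt_xy.
by rewrite (distrC (f x)) (distrC x) eq_c normrM ler_wpM2r.
Qed.

Lemma lipschitz_ge0 f (L : R) : L.-lipschitz f -> 0 <= L.
Proof.
move=> /(_ (1, 0) (conj I I)); rewrite /= subr0 normr1 mulr1.
exact: le_trans.
Qed.

Lemma is_derive_lipschitz_increment f df (L x y z : R) :
  (forall x : R, is_derive x 1 f (df x)) -> L.-lipschitz df -> x <= z <= y ->
  `|f y - f x - df z * (y - x)| <= L * (y - x) ^+ 2.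
Proof.
move=> f_df df_lip /andP [le_xz le_zy]; have := le_trans le_xz le_zy.
rewrite le_eqVlt => /orP [/eqP <-|lt_xy].
  by rewrite !subrr mulr0 subr0 normr0 expr0n mulr0.
have [w /andP [lt_xw lt_wy] ->] := is_derive_MVT f_df lt_xy.
have yx_gt0 : 0 < y - x by rewrite subr_gt0.
rewrite -mulrBl normrM (gtr0_norm yx_gt0) expr2 mulrA ler_pM2r //.
apply: le_trans (df_lip (w, z) (conj I I)) _; rewrite ler_wpM2l ?(lipschitz_ge0 df_lip) //=.
by rewrite ler_norml; lra.
Qed.

End derivatives.

(** * The standard normal distribution *)

Section standard_normal.
Variable R : realType.
Local Notation mu := (@lebesgue_measure R).

Definition std_normal_pdf (x : R) : R := normal_pdf 0 1 x.
Local Notation phi := std_normal_pdf.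
Local Notation Phi := (@std_normal_cdf R).

Lemma std_normal_pdfE x : phi x = normal_peak 1 * expR (- x ^+ 2 / 2).
Proof. by rewrite /phi normal_pdfE ?oner_eq0 // /normal_fun subr0 expr1n. Qed.

Lemma std_normal_pdf_gt0 x : 0 < phi x.
Proof. by rewrite std_normal_pdfE mulr_gt0 ?expR_gt0 // normal_peak_gt0 ?oner_eq0. Qed.

Lemma std_normal_pdfN x : phi (- x) = phi x.
Proof. by rewrite !std_normal_pdfE sqrrN. Qed.

Lemma continuous_std_normal_pdf : continuous phi.
Proof. by apply: continuous_normal_pdf; rewrite oner_eq0. Qed.

Lemma is_derive_std_normal_pdf (x : R) : is_derive x 1 phi (- x * phi x).
Proof.
rewrite (funext std_normal_pdfE); apply: is_derive_eq.
by rewrite /GRing.scale /=; field.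
Qed.

Lemma is_derive_integralNy (f : R -> R) (x : R) :
  continuous f -> mu.-integrable setT (EFin \o f) ->
  is_derive x 1 (fun y => \int[mu]_(t in `]-oo, y]) f t)%R (f x).
Proof.
move=> f_cont f_int; have [] := @continuous_FTC1 R f (BInfty _ true) x (x + 1).
- by rewrite ltrDl.
- exact: integrableS f_int.
- by rewrite ltNyr.
- exact: f_cont.
by move=> df f_df; apply: DeriveDef; rewrite // -f_df derive1E.
Qed.

Lemma is_derive_std_normal_cdf (x : R) : is_derive x 1 Phi (phi x).
Proof.
exact: is_derive_integralNy continuous_std_normal_pdf (integrable_normal_pdf 0 1).
Qed.

Let P := (normal_prob (0 : R) 1).

Let idTR : measurableTypeR R -> R := idfun.

#[local] HB.instance Definition _ :=
  @isMeasurableFun.Build _ _ _ _ idTR (@measurable_id _ _ setT).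

Let X : {RV P >-> R} := idTR.

Lemma cvg_std_normal_cdfy : Phi x @[x --> +oo] --> (1 : R).
Proof. exact: fine_cvg (cvg_cdfy1 X). Qed.

Lemma cvg_std_normal_cdfNy : Phi x @[x --> -oo] --> (0 : R).
Proof. exact: fine_cvg (cvg_cdfNy0 X). Qed.

Lemma std_normal_cdf_itv01 (x : R) : 0 <= Phi x <= 1.
Proof.
by rewrite fine_ge0 //= -lee_fin fineK ?fin_num_measure // probability_le1.
Qed.

Lemma std_normal_cdf_nondecreasing : {homo Phi : x y / x <= y}.
Proof.
move=> x y; apply: is_derive_ge0_le is_derive_std_normal_cdf _ => z _.
exact/ltW/std_normal_pdf_gt0.
Qed.

Lemma continuous_std_normal_cdf : continuous Phi.
Proof. exact: is_derive_continuous is_derive_std_normal_cdf. Qed.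

Lemma std_normal_cdfN x : Phi (- x) = 1 - Phi x.
Proof.
have d0 (y : R) : is_derive y 1 (fun z => Phi z + Phi (- z)) 0.
  have dPhi := is_derive_std_normal_cdf y.
  have dPhiN : is_derive y 1 (Phi \o -%R) (phi (- y) * - 1).
    by apply: is_derive1_comp; apply: is_derive_std_normal_cdf.
  by apply: is_derive_eq; rewrite std_normal_pdfN mulrN1 subrr.
apply/eqP; rewrite eq_sym subr_eq addrC eq_sym; apply/eqP.
have cvg_sum : (fun z => Phi z + Phi (- z)) z @[z --> +oo] --> (1 + 0 : R).
  apply: cvgD cvg_std_normal_cdfy _.
  apply: (cvg_comp _ _ _ cvg_std_normal_cdfNy).
  exact/cvgNrNy.
have sum_cst : (fun z => Phi z + Phi (- z)) = cst (Phi x + Phi (- x)).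
  by apply/funext => z; apply: is_derive_0_is_cst d0.
by rewrite -[RHS]addr0; apply: (cvg_unique _ _ cvg_sum); rewrite // sum_cst; apply: cvg_cst.
Qed.

(* Mills' bounds, by monotonicity on the half-line above [x] and comparison with
   the values at infinity. *)
Lemma mills_upper x : 0 < x -> x * (1 - Phi x) <= phi x.
Proof.
move=> x_gt0; suff : x * 1 <= phi x + x * Phi x by rewrite mulrBr lerBlDr.
have cvg_xPhi : x * Phi y @[y --> +oo] --> x * 1.
  by apply: cvgM cvg_std_normal_cdfy; apply: cvg_cst.
apply: (cvgr_to_le cvg_xPhi).
pose u y := phi y + x * Phi y.
have du (y : R) : is_derive y 1 u ((x - y) * phi y).
  have dPhi := is_derive_std_normal_cdf y; have dphi := is_derive_std_normal_pdf y.
  by apply: is_derive_eq; rewrite /GRing.scale /=; ring.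
near=> y; apply: (@le_trans _ _ (u y)); first by rewrite lerDr ltW // std_normal_pdf_gt0.
apply: is_derive_le0_ge du _ _ => [z /andP [xz _]|].
  by rewrite mulr_le0_ge0 ?subr_le0 ?ltW // std_normal_pdf_gt0.
by near: y; apply: nbhs_pinfty_ge; rewrite num_real.
Unshelve. all: by end_near. Qed.

Lemma mills_lower x : 0 < x -> x * phi x <= (1 + x ^+ 2) * (1 - Phi x).
Proof.
move=> x_gt0.
have pos y : 0 < 1 + y ^+ 2 :> R by rewrite ltr_pwDl // sqr_ge0.
pose v y := y * phi y / (1 + y ^+ 2) + Phi y.
have dv (y : R) : is_derive y 1 v (2 * phi y / (1 + y ^+ 2) ^+ 2).
  have dPhi := is_derive_std_normal_cdf y; have dphi := is_derive_std_normal_pdf y.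
  have nz : 1 + y ^+ 2 != 0 by rewrite gt_eqF.
  have dsq : is_derive y 1 (fun z : R => 1 + z ^+ 2) (2 * y).
    by apply: is_derive_eq; rewrite /GRing.scale /=; ring.
  have dinv := @is_deriveV R (fun z => 1 + z ^+ 2) y (2 * y) 1 nz dsq.
  by apply: is_derive_eq; rewrite /GRing.scale /=; field.
suff v_le1 : v x <= 1.
  by rewrite mulrC [leRHS]mulrC -ler_pdivrMr // lerBrDr mulrC.
pose C := normal_peak (1 : R).
apply/ler_addgt0Pr => e e_gt0; pose y := Num.max x (C / e).
have xy : x <= y by rewrite le_max lexx.
have y_gt0 : 0 < y := lt_le_trans x_gt0 xy.
have Ce : C <= y * e by rewrite -ler_pdivrMr // le_max lexx orbT.
apply: le_trans (is_derive_ge0_le dv _ xy) _ => [z _|].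
  by rewrite divr_ge0 ?sqr_ge0 // mulr_ge0 // ltW // std_normal_pdf_gt0.
have phi_le : phi y <= C by apply: normal_pdf_ub; rewrite oner_eq0.
have /andP [_ Phi_le1] := std_normal_cdf_itv01 y.
rewrite addrC lerD // ler_pdivrMr //.
by have := std_normal_pdf_gt0 y; nra.
Qed.

End standard_normal.

(** * Stein's equation *)

Section stein_equation.
Variables (R : realType) (h : R -> R) (a b k : R).
Hypotheses (h01 : forall x, 0 <= h x <= 1).
Hypotheses (h_left : forall x, x <= a -> h x = 1) (h_right : forall x, b <= x -> h x = 0).
Hypothesis h_lip : k.-lipschitz h.
Local Notation Phi := (@std_normal_cdf R).
Local Notation phi := (@std_normal_pdf R).
Local Notation mu := (@lebesgue_measure R).

Let h_cont : continuous h := lipschitz_continuous h_lip.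

Let h_phi_le x : 0 <= h x * phi x <= phi x.
Proof.
have /andP [h_ge0 h_le1] := h01 x; have phi_ge0 := ltW (std_normal_pdf_gt0 x).
by rewrite mulr_ge0 //= ler_piMl.
Qed.

Let lt_ab : a < b.
Proof.
rewrite ltNge; apply/negP => le_ba.
by have := h_left (lexx a); rewrite h_right // => /eqP; rewrite eq_sym oner_eq0.
Qed.

Definition normal_partial_mean (x : R) : R := (\int[mu]_(t in `]-oo, x]) (h t * phi t))%R.

Lemma is_derive_normal_partial_mean (x : R) :
  is_derive x 1 normal_partial_mean (h x * phi x).
Proof.
have h_phi_cont : continuous (fun t => h t * phi t).
  by move=> y; apply: cvgM; [apply: h_cont | apply: continuous_std_normal_pdf].
apply: (@is_derive_integralNy _ (fun t => h t * phi t)) => //.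
apply: le_integrable (integrable_normal_pdf 0 1) => //.
  by apply/measurable_EFinP; apply: measurable_funTS; apply: continuous_measurable_fun.
move=> y _; have /andP [h_phi_ge0 h_phi_phi] := h_phi_le y.
by rewrite /= !ger0_norm ?lee_fin // (le_trans h_phi_ge0).
Qed.

Lemma normal_partial_mean_left x : x <= a -> normal_partial_mean x = Phi x.
Proof.
move=> le_xa; apply: eq_Rintegral => t; rewrite inE /= in_itv /= => le_tx.
by rewrite h_left ?mul1r // (le_trans le_tx).
Qed.

Definition normal_mean : R := normal_partial_mean b.
Local Notation c := normal_mean.

Lemma normal_partial_mean_right x : b <= x -> normal_partial_mean x = c.
Proof.
move=> le_bx; apply/eqP; rewrite eq_le; apply/andP; split;
  [apply: is_derive_le0_ge le_bx | apply: is_derive_ge0_le le_bx];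
  try exact: is_derive_normal_partial_mean;
  by move=> z /andP [/ltW bz _]; rewrite h_right // mul0r.
Qed.

Lemma normal_mean_bounds : Phi a <= c <= Phi b.
Proof.
apply/andP; split.
  rewrite -(normal_partial_mean_left (lexx a)).
  apply: is_derive_ge0_le is_derive_normal_partial_mean _ (ltW lt_ab) => z _.
  by case/andP: (h_phi_le z).
have d_diff (z : R) :
    is_derive z 1 (fun y => Phi y - normal_partial_mean y) (phi z - h z * phi z).
  have dmean := is_derive_normal_partial_mean z.
  by have dPhi := is_derive_std_normal_cdf z; apply: is_deriveB.
rewrite -subr_ge0 -[leLHS](subrr (Phi a)) -{2}(normal_partial_mean_left (lexx a)).
apply: (is_derive_ge0_le d_diff _ (ltW lt_ab)) => z _.
by rewrite subr_ge0; case/andP: (h_phi_le z).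
Qed.

Let c01 : 0 <= c <= 1.
Proof.
have /andP [Phi_c c_Phi] := normal_mean_bounds.
have /andP [Phi_ge0 _] := std_normal_cdf_itv01 a.
have /andP [_ Phi_le1] := std_normal_cdf_itv01 b.
by rewrite (le_trans Phi_ge0) //= (le_trans c_Phi).
Qed.

Definition stein_solution (x : R) : R := (normal_partial_mean x - c * Phi x) / phi x.
Local Notation F := stein_solution.

Definition stein_solution_deriv (x : R) : R := x * F x + h x - c.
Local Notation dF := stein_solution_deriv.

Lemma is_derive_stein_solution (x : R) : is_derive x 1 F (dF x).
Proof.
have phi_neq0 : phi x != 0 by rewrite gt_eqF // std_normal_pdf_gt0.
have dmean := is_derive_normal_partial_mean x; have dPhi := is_derive_std_normal_cdf x.
have dphi := is_derive_std_normal_pdf x; have dinv := is_deriveV phi_neq0 dphi.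
rewrite /stein_solution; apply: is_derive_eq.
by rewrite /GRing.scale /= /stein_solution_deriv /stein_solution; field.
Qed.

Let dxF (x : R) : R := F x + x * dF x.

Let is_derive_mul_stein_solution (x : R) : is_derive x 1 (fun y => y * F y) (dxF x).
Proof.
have dFx := is_derive_stein_solution x; apply: is_derive_eq.
by rewrite /GRing.scale /= /dxF; ring.
Qed.

Let mills_gap (y : R) : 1 <= y -> 0 <= (1 + y ^+ 2) * ((1 - Phi y) / phi y) - y <= 1.
Proof.
move=> y_ge1; have y_gt0 := lt_le_trans ltr01 y_ge1; have phi_gt0 := std_normal_pdf_gt0 y.
have lower := mills_lower y_gt0; have upper := mills_upper y_gt0.
rewrite subr_ge0 mulrA ler_pdivlMr // lower /= lerBlDr ler_pdivrMr //.
by have /andP [_ Phi_le1] := std_normal_cdf_itv01 y; nra.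
Qed.

Let dxF_right (x : R) : 1 <= x -> b <= x -> `|dxF x| <= 1.
Proof.
move=> x_ge1 le_bx; have /andP [gap_ge0 gap_le1] := mills_gap x_ge1.
have /andP [c_ge0 c_le1] := c01.
have phi_neq0 : phi x != 0 by rewrite gt_eqF // std_normal_pdf_gt0.
have -> : dxF x = c * ((1 + x ^+ 2) * ((1 - Phi x) / phi x) - x).
  rewrite /dxF /stein_solution_deriv /stein_solution h_right // normal_partial_mean_right //.
  by field.
by rewrite ger0_norm ?mulr_ge0 // mulr_ile1.
Qed.

Let dxF_left (x : R) : x <= - 1 -> x <= a -> `|dxF x| <= 1.
Proof.
move=> x_le1 le_xa; have Nx_ge1 : 1 <= - x by lra.
have /andP [gap_ge0 gap_le1] := mills_gap Nx_ge1; have /andP [c_ge0 c_le1] := c01.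
have phi_neq0 : phi x != 0 by rewrite gt_eqF // std_normal_pdf_gt0.
have -> : dxF x = (1 - c) * ((1 + (- x) ^+ 2) * ((1 - Phi (- x)) / phi (- x)) - - x).
  rewrite /dxF /stein_solution_deriv /stein_solution h_left // normal_partial_mean_left //.
  by rewrite std_normal_cdfN std_normal_pdfN; field.
have Nc_ge0 : 0 <= 1 - c by rewrite subr_ge0.
by rewrite ger0_norm ?mulr_ge0 // mulr_ile1 // gerBl.
Qed.

(* Outside a compact interval the bound comes from Mills' inequalities. *)
Let dxF_bounded : exists L, forall x, `|dxF x| <= L.
Proof.
pose A := Num.max 1 (Num.max (- a) b).
have A_ge1 : 1 <= A by rewrite le_max lexx.
have Aa : - A <= a by rewrite lerNl !le_max lexx orbT.
have bA : b <= A by rewrite !le_max lexx !orbT.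
have F_cont : continuous F := is_derive_continuous is_derive_stein_solution.
have dxF_cont : continuous dxF.
  move=> x; apply: cvgD; first exact: F_cont.
  apply: cvgM; first exact: cvg_id.
  apply: cvgB; last exact: cvg_cst.
  apply: cvgD; last exact: h_cont.
  by apply: cvgM; [exact: cvg_id | exact: F_cont].
have norm_cont : {within `[- A, A], continuous (fun x => `|dxF x|)}.
  by apply: continuous_subspaceT => x; apply: cvg_norm; apply: dxF_cont.
have le_AA : - A <= A by lra.
have [m _ m_max] := EVT_max le_AA norm_cont.
exists (Num.max 1 `|dxF m|) => x.
have [le_xA|lt_Ax] := leP x A; last first.
  by rewrite le_max dxF_right ?(le_trans A_ge1) ?(le_trans bA) // ltW.
have [le_Ax|lt_xA] := leP (- A) x.
  by rewrite le_max m_max ?orbT // in_itv /= le_Ax.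
by rewrite le_max dxF_left //; lra.
Qed.

Lemma stein_solution_deriv_lipschitz : exists L, L.-lipschitz dF.
Proof.
have [L dxF_le] := dxF_bounded; exists (L + k) => -[x y] xy /=.
have -> : dF x - dF y = (x * F x - y * F y) + (h x - h y).
  by rewrite /stein_solution_deriv; ring.
rewrite mulrDl; apply: le_trans (ler_normD _ _) (lerD _ (h_lip xy)).
exact: (is_derive_lipschitz is_derive_mul_stein_solution dxF_le xy).
Qed.

End stein_equation.

Section ramp.
Variables (R : realType) (a b : R).
Hypothesis lt_ab : a < b.

Definition ramp (x : R) : R := Num.max 0 (Num.min 1 ((b - x) / (b - a))).

Let ba_gt0 : 0 < b - a. Proof. by rewrite subr_gt0. Qed.

Lemma ramp_itv01 x : 0 <= ramp x <= 1.
Proof. by rewrite le_max lexx ge_max ler01 ge_min lexx. Qed.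

Lemma ramp_left x : x <= a -> ramp x = 1.
Proof.
move=> le_xa; rewrite /ramp min_l ?max_r ?ler01 //.
by rewrite ler_pdivlMr // mul1r lerD2l lerN2.
Qed.

Lemma ramp_right x : b <= x -> ramp x = 0.
Proof.
move=> le_bx; rewrite /ramp max_l // ge_min; apply/orP; right.
by rewrite ler_pdivrMr // mul0r subr_le0.
Qed.

Lemma ramp_lipschitz : ((b - a)^-1).-lipschitz ramp.
Proof.
move=> [x y] _ /=; have -> : (b - a)^-1 * `|x - y| = `|(b - x) / (b - a) - (b - y) / (b - a)|.
  rewrite -mulrBl normrM mulrC normfV (gtr0_norm ba_gt0) distrC; congr (`|_| * _).
  by ring.
rewrite /ramp; move: ((b - x) / _) ((b - y) / _) => u v.
rewrite ler_norml; have := ler_norm (u - v); have := ler_norm (v - u).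
rewrite (distrC v) => ? ?; rewrite /Num.max /Num.min.
case: (Order.TotalTheory.ltP 1 u) => ?; case: (Order.TotalTheory.ltP 1 v) => ?;
  do ?[case: Order.TotalTheory.ltP => ?]; lra.
Qed.

End ramp.

(** * Convergence of distribution functions *)

Section distribution_functions.
Variable R : realType.
Implicit Types f G : R -> R.

Lemma quantile_exists G (v : R) : continuous G ->
  G x @[x --> -oo] --> (0 : R) -> G x @[x --> +oo] --> (1 : R) ->
  0 < v < 1 -> exists x, G x = v.
Proof.
move=> G_cont G0 G1 /andP [v_gt0 v_lt1].
have [a [_ aP]] := cvgr_le _ G0 _ v_gt0; have [b [_ bP]] := cvgr_ge _ G1 _ v_lt1.
pose x := Num.min a b - 1; pose y := Num.max a b + 1.
have lt_xa : x < a by rewrite ltrBlDr ltr_pwDr // ge_min lexx.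
have lt_by : b < y by rewrite ltr_pwDr // le_max lexx orbT.
have le_xy : x <= y.
  rewrite lerBlDr -addrA; apply: le_trans (_ : Num.max a b <= _); last by rewrite lerDl.
  by rewrite ge_min le_max lexx.
have [||z _ <-] := @IVT _ G x y v le_xy; last by exists z.
  exact: continuous_subspaceT.
by rewrite ge_min le_max (aP _ lt_xa) (bP _ lt_by) orbT.
Qed.

Lemma cdf_grid_exists G (e : R) : continuous G ->
  G x @[x --> -oo] --> (0 : R) -> G x @[x --> +oo] --> (1 : R) -> 0 < e ->
  exists N, exists t : nat -> R,
    [/\ G (t 0%N) <= e, 1 - e <= G (t N) & forall i, (i < N)%N -> G (t i.+1) <= G (t i) + e].
Proof.
move=> G_cont G0 G1 e_gt0; pose N := Num.bound e^-1; pose d : R := N.+2%:R^-1.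
have d_gt0 : 0 < d by rewrite invr_gt0.
have d_le : d <= e.
  rewrite -[leRHS]invrK lef_pV2 ?posrE ?invr_gt0 //.
  apply/ltW/(lt_le_trans (archi_boundP _)); first by rewrite invr_ge0 ltW.
  by rewrite ler_nat -/N; lia.
have Nd : N.+2%:R * d = 1 by rewrite /d mulfV.
have /choice[t tP] i : exists x, (i <= N)%N -> G x = i.+1%:R * d.
  have [le_iN|_] := leqP i N; last by exists 0.
  have [|x Gx] := @quantile_exists G (i.+1%:R * d) G_cont G0 G1; last by exists x.
  by rewrite mulr_gt0 //= -[ltRHS]Nd ltr_pM2r // ltr_nat.
exists N, t; split=> [||i lt_iN]; rewrite ?tP //.
- by rewrite mul1r.
- by have := Nd; rewrite -[N.+2%:R]natr1; lra.
- by rewrite -[i.+2%:R]natr1 mulrDl mul1r lerD2l.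
exact: ltnW.
Qed.

Lemma close_of_grid f G (e : R) (t : nat -> R) N :
  {homo f : x y / x <= y} -> {homo G : x y / x <= y} ->
  (forall x, 0 <= f x <= 1) -> (forall x, 0 <= G x <= 1) ->
  G (t 0%N) <= e -> 1 - e <= G (t N) ->
  (forall i, (i < N)%N -> G (t i.+1) <= G (t i) + e) ->
  (forall i, (i <= N)%N -> `|f (t i) - G (t i)| <= e) ->
  forall x, `|f x - G x| <= 2 * e.
Proof.
move=> f_homo G_homo f01 G01 G_first G_last G_step f_near x.
have /andP [f_ge0 f_le1] := f01 x; have /andP [G_ge0 G_le1] := G01 x.
have [|lt_Nx] := Order.TotalTheory.leP x (t N); last first.
  have := f_near N (leqnn N); have := f_homo _ _ (ltW lt_Nx); have := G_homo _ _ (ltW lt_Nx).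
  by rewrite !ler_norml; lra.
elim: N G_step f_near {G_last} => [|N IHN] G_step f_near le_xN.
  have := f_near 0%N isT; have := f_homo _ _ le_xN; have := G_homo _ _ le_xN.
  by rewrite !ler_norml; lra.
have [le_x|lt_x] := Order.TotalTheory.leP x (t N).
  by apply: IHN => // i lt_iN; [apply: G_step | apply: f_near]; rewrite leqW.
have := f_near N (leqnSn N); have := f_near N.+1 (leqnn _); have := G_step N (leqnn _).
have := f_homo _ _ le_xN; have := f_homo _ _ (ltW lt_x).
have := G_homo _ _ le_xN; have := G_homo _ _ (ltW lt_x).
by rewrite !ler_norml; lra.
Qed.

Section filter.
Variables (T : Type) (F : set_system T).
Context {FF : Filter F}.
Variables (f : T -> R -> R) (G : R -> R).
Hypothesis G_cont : continuous G.

Lemma polya_cdf_cvg_uniform :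
  (\forall n \near F, {homo f n : x y / x <= y} /\ forall x, 0 <= f n x <= 1) ->
  {homo G : x y / x <= y} -> (forall x, 0 <= G x <= 1) ->
  G x @[x --> -oo] --> (0 : R) -> G x @[x --> +oo] --> (1 : R) ->
  (forall x, f n x @[n --> F] --> G x) ->
  forall e, 0 < e -> \forall n \near F, forall x, `|f n x - G x| <= e.
Proof.
move=> f_cdf G_homo G01 G0 G1 f_cvg e e_gt0; have e2_gt0 : 0 < e / 2 by rewrite divr_gt0.
have [N [t [G_first G_last G_step]]] := cdf_grid_exists G_cont G0 G1 e2_gt0.
have f_near : \forall n \near F, forall i : 'I_N.+1, `|G (t i) - f n (t i)| <= e / 2.
  by apply: filter_forall => i; apply: cvgr_dist_le.
near=> n => x; have [f_homo f01] : {homo f n : x y / x <= y} /\ forall x, 0 <= f n x <= 1.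
  by near: n.
rewrite (_ : e = 2 * (e / 2)); last by field.
apply: (close_of_grid f_homo G_homo f01 G01 G_first G_last G_step) => i le_iN.
have near_i : forall i : 'I_N.+1, `|G (t i) - f n (t i)| <= e / 2 by near: n.
by rewrite distrC; apply: (near_i (Ordinal (le_iN : (i < N.+1)%N))).
Unshelve. all: by end_near. Qed.

Lemma cdf_cvg_of_test_functions :
  (forall a b, a < b -> exists2 c, G a <= c <= G b &
     exists2 u : T -> R, u n @[n --> F] --> c & \forall n \near F, f n a <= u n <= f n b) ->
  forall x, f n x @[n --> F] --> G x.
Proof.
move=> test x; apply/cvgrPdist_le => e e_gt0; have e2_gt0 : 0 < e / 2 by rewrite divr_gt0.
have [d /= d_gt0 dP] := (nbhs_ballP _ _).1 (cvgr_dist_le _ _ (G_cont (x := x)) _ e2_gt0).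
have ball_x y : `|x - y| = d / 2 -> `|G x - G y| <= e / 2.
  by move=> dist_y; apply: dP; rewrite /ball /= dist_y; lra.
have left_x := ball_x (x - d / 2); have right_x := ball_x (x + d / 2).
have d2_ge0 : 0 <= d / 2 by rewrite divr_ge0 // ltW.
rewrite opprB addrCA subrr addr0 ger0_norm // in left_x.
rewrite opprD addrA subrr sub0r normrN ger0_norm // in right_x.
have [|c1 /andP [_ c1_le] [u1 u1_cvg u1P]] := test x (x + d / 2); first by lra.
have [|c2 /andP [c2_ge _] [u2 u2_cvg u2P]] := test (x - d / 2) x; first by lra.
near=> n.
have u1_near : `|c1 - u1 n| <= e / 2 by near: n; apply: cvgr_dist_le.
have u2_near : `|c2 - u2 n| <= e / 2 by near: n; apply: cvgr_dist_le.
have /andP [f_le _] : f n x <= u1 n <= f n (x + d / 2) by near: n.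
have /andP [_ f_ge] : f n (x - d / 2) <= u2 n <= f n x by near: n.
move: (left_x erefl) (right_x erefl) u1_near u2_near; rewrite !ler_norml; lra.
Unshelve. all: by end_near. Qed.

End filter.
End distribution_functions.

(** * Asymptotic normality *)

Section nonpos_rooted_polynomials.
Variable R : realType.
Implicit Types p : {poly R}.

(* The root [r <= 0] gives a Bernoulli variable of parameter [1 / (1 - r)]. *)
Lemma nonpos_rooted_poisson_binomial p : nonpos_rooted p ->
  exists2 ps, bernoulli_params ps & p = p.[1] *: poisson_binomial ps.
Proof.
case=> rs rs_le0; move: (lead_coef p) => c ->; exists [seq (1 - r)^-1 | r <- rs].
  apply/allP => _ /mapP [r /(allP rs_le0) /= r_le0 ->].
  by rewrite invr_ge0 invf_le1; lra.
rewrite hornerZ -scalerA /poisson_binomial big_map; congr (_ *: _).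
rewrite horner_prod -mul_polyC rmorph_prod -big_split /=.
rewrite [LHS]big_seq [RHS]big_seq; apply: eq_bigr => r /(allP rs_le0) /= r_le0.
have r1_neq0 : 1 - r != 0 by rewrite gt_eqF //; lra.
rewrite hornerXsubC mul_polyC /bernoulli_pgf scalerDr scalerA mulfV // scale1r addrC.
by rewrite -mul_polyC -polyCM mulrBr mulr1 mulfV // addrAC subrr add0r polyCN.
Qed.

Lemma nonpos_rooted_has_coef_distr p :
  nonpos_rooted p -> 0 < p.[1] -> has_coef_distr p.
Proof.
move=> /nonpos_rooted_poisson_binomial [ps ps01 pE] p1_gt0; split=> // k.
by rewrite {1}pE coefZ mulr_ge0 ?(ltW p1_gt0) // poisson_binomial_coef_ge0.
Qed.

Section poisson_binomial_expectation.
Variables (p : {poly R}) (ps : seq R).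
Hypotheses (ps01 : bernoulli_params ps) (p1_neq0 : p.[1] != 0).
Hypothesis pE : p = p.[1] *: poisson_binomial ps.

Lemma coef_expect_poisson_binomial f :
  coef_expect p f = coef_pairing f (poisson_binomial ps).
Proof. by rewrite /coef_expect {1}pE linearZ /= mulrAC mulfV // mul1r. Qed.

Lemma coef_mean_poisson_binomial : coef_mean p = pb_mean ps.
Proof.
rewrite coef_meanE coef_expect_poisson_binomial.
rewrite (@eq_coef_pairing _ _ (fun k => (k%:R - pb_mean ps) + pb_mean ps * 1)); last first.
  by move=> k; rewrite mulr1 subrK.
rewrite coef_pairing_addf coef_pairing_scalef coef_pairing1 poisson_binomial_horner1.
by rewrite poisson_binomial_centered // add0r mulr1.
Qed.

Lemma coef_var_poisson_binomial : coef_var p = pb_var ps.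
Proof.
by rewrite coef_varE coef_expect_poisson_binomial coef_mean_poisson_binomial poisson_binomial_var.
Qed.

End poisson_binomial_expectation.

Lemma coef_expect_stein p (F dF : R -> R) (L : R) :
  nonpos_rooted p -> p.[1] != 0 -> 0 < coef_var p ->
  (forall x : R, is_derive x 1 F (dF x)) -> L.-lipschitz dF ->
  `|coef_expect p (fun k => dF (coef_std p k) - coef_std p k * F (coef_std p k))| <=
  L / Num.sqrt (coef_var p).
Proof.
move=> /nonpos_rooted_poisson_binomial [ps ps01 pE] p1_neq0 var_gt0 F_dF dF_lip.
set s := Num.sqrt _; set W := coef_std p.
have s_gt0 : 0 < s by rewrite sqrtr_gt0.
have s_neq0 : s != 0 by rewrite gt_eqF.
have WS k : W k.+1 - W k = s^-1 by rewrite /W /coef_std -/s -natr1; field.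
have increment k j : (k <= j <= k.+1)%N ->
    `|F (W k.+1) - F (W k) - dF (W j) / s| <= L / s ^+ 2.
  move=> /andP [le_kj le_jk]; rewrite -exprVn -(WS k).
  apply: is_derive_lipschitz_increment => //.
  by rewrite !ler_pM2r ?invr_gt0 // !lerD2r !ler_nat le_kj.
have varE : pb_var ps = s ^+ 2.
  by rewrite sqr_sqrtr ?(ltW var_gt0) // (coef_var_poisson_binomial ps01 p1_neq0 pE).
have := poisson_binomial_stein ps01 increment; rewrite varE divfK ?expf_neq0 // => discr_le.
rewrite (coef_expect_poisson_binomial p1_neq0 pE) ler_pdivlMr //.
rewrite -[X in _ * X <= _](gtr0_norm s_gt0) -normrM.
apply: le_trans discr_le; rewrite -normrN le_eqVlt; apply/orP; left; apply/eqP; congr `|_|.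
rewrite /stein_discrepancy varE (@eq_coef_pairing _ _ (fun k =>
  s * (dF (W k) / s) + - s^-1 * ((k%:R - pb_mean ps) * F (W k)))); last first.
  move=> k; rewrite -(coef_mean_poisson_binomial ps01 p1_neq0 pE).
  by rewrite [in X in _ - X * _]/W /coef_std -/s; field.
by rewrite coef_pairing_addf !coef_pairing_scalef; field.
Qed.

End nonpos_rooted_polynomials.

Section asymptotic_normality.
Variable R : realType.
Implicit Types (p : {poly R}) (P Q : nat -> {poly R}).
Local Notation Phi := (@std_normal_cdf R).

Lemma normal_distance_le p (e : R) :
  (forall x, `|coef_cdf p x - Phi x| <= e) -> normal_distance p <= e.
Proof.
move=> cdf_le; apply: ge_sup => [|_ [x _ <-]]; first by eexists; exists 0.
by rewrite coef_cdfE.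
Qed.

Lemma le_normal_distance p x :
  has_coef_distr p -> `|coef_cdf p x - Phi x| <= normal_distance p.
Proof.
move=> p_distr; apply: ub_le_sup; last by exists x; rewrite // coef_cdfE.
exists 1 => _ [y _ <-]; rewrite coef_cdfE ler_norml.
by have := coef_cdf_itv01 y p_distr; have := std_normal_cdf_itv01 y; lra.
Qed.

Lemma asymptotically_normalP P : asymptotically_normal P <->
  (\forall n \near \oo, has_coef_distr (P n)) /\
  (forall e : R, 0 < e -> \forall n \near \oo, forall x, `|coef_cdf (P n) x - Phi x| <= e).
Proof.
split=> -[P_distr P_cvg]; split=> //.
  move=> e e_gt0; near=> n => x; apply: (@le_trans _ _ (normal_distance (P n))).
    by apply: le_normal_distance; near: n.
  apply: le_trans (ler_norm _) _; rewrite -normrN -sub0r.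
  by near: n; apply: cvgr_dist_le.
apply/cvgrPdist_le => e e_gt0; near=> n; rewrite sub0r normrN ger0_norm.
  by apply: normal_distance_le; near: n; apply: P_cvg.
by apply: le_trans (le_normal_distance 0 _) => //; near: n.
Unshelve. all: by end_near. Qed.

Lemma asymptotically_normal_perturb P Q (u : nat -> R) :
  asymptotically_normal P -> (\forall n \near \oo, has_coef_distr (Q n)) ->
  (\forall n \near \oo, coef_mean (Q n) = coef_mean (P n) /\ coef_var (Q n) = coef_var (P n)) ->
  (\forall n \near \oo, forall f, (forall k, `|f k| <= 1) ->
     `|coef_expect (Q n) f - coef_expect (P n) f| <= u n) ->
  u n @[n --> \oo] --> (0 : R) -> asymptotically_normal Q.
Proof.
move=> /asymptotically_normalP [_ P_cvg] Q_distr QP_moments QP_close u0.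
apply/asymptotically_normalP; split=> // e e_gt0; have e2_gt0 : 0 < e / 2 by rewrite divr_gt0.
near=> n => x.
have [meanE varE] : coef_mean (Q n) = coef_mean (P n) /\ coef_var (Q n) = coef_var (P n).
  by near: n.
have u_le : `|0 - u n| <= e / 2 by near: n; apply: cvgr_dist_le.
have P_close : `|coef_cdf (P n) x - Phi x| <= e / 2.
  by move: x; near: n; apply: P_cvg.
have Q_close : `|coef_cdf (Q n) x - coef_cdf (P n) x| <= u n.
  have close_n : forall f, (forall k, `|f k| <= 1) ->
    `|coef_expect (Q n) f - coef_expect (P n) f| <= u n by near: n.
  by rewrite /coef_cdf meanE varE; apply: close_n => k; rewrite normr_nat lern1 leq_b1.
by move: u_le P_close Q_close; rewrite sub0r normrN !ler_norml; lra.
Unshelve. all: by end_near. Qed.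

Section nonpos_rooted_sequence.
Variable P : nat -> {poly R}.
Hypothesis P_rooted : \forall n \near \oo, nonpos_rooted (P n) /\ 0 < (P n).[1].
Hypothesis var_cvg : coef_var (P n) @[n --> \oo] --> +oo.

Lemma coef_expect_ramp_cvg (a b : R) : a < b ->
  coef_expect (P n) (fun k => ramp a b (coef_std (P n) k)) @[n --> \oo] -->
  normal_mean (ramp a b) b.
Proof.
move=> lt_ab; have [L dF_lip] := stein_solution_deriv_lipschitz (ramp_itv01 a b) (ramp_left lt_ab)
  (ramp_right lt_ab) (ramp_lipschitz lt_ab).
have L_ge0 := lipschitz_ge0 dF_lip.
apply/cvgrPdist_le => e e_gt0; near=> n; rewrite distrC.
have [rooted_n P1_gt0] : nonpos_rooted (P n) /\ 0 < (P n).[1] by near: n.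
have var_gt : (L / e) ^+ 2 < coef_var (P n) by near: n; apply: cvgry_gt.
have var_gt0 : 0 < coef_var (P n) := le_lt_trans (sqr_ge0 _) var_gt.
have P1_neq0 : (P n).[1] != 0 by rewrite gt_eqF.
have := coef_expect_stein rooted_n P1_neq0 var_gt0
  (is_derive_stein_solution b (ramp_itv01 a b) (ramp_lipschitz lt_ab)) dF_lip.
rewrite (@eq_coef_expect _ _ _
  (fun k => ramp a b (coef_std (P n) k) + - normal_mean (ramp a b) b)); last first.
  by move=> k; rewrite /stein_solution_deriv; ring.
rewrite coef_expect_addf coef_expect_cst; last exact: nonpos_rooted_has_coef_distr.
move/le_trans; apply; rewrite ler_pdivrMr ?sqrtr_gt0 // mulrC -ler_pdivrMr // ltW //.
by rewrite -(ger0_norm (divr_ge0 L_ge0 (ltW e_gt0))) -sqrtr_sqr ltr_sqrt.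
Unshelve. all: by end_near. Qed.

Lemma coef_cdf_cvg x : coef_cdf (P n) x @[n --> \oo] --> Phi x.
Proof.
move: x; apply: cdf_cvg_of_test_functions.
  exact: continuous_std_normal_cdf.
move=> a b lt_ab; exists (normal_mean (ramp a b) b).
  exact: normal_mean_bounds (ramp_itv01 a b) (ramp_left lt_ab) (ramp_right lt_ab)
    (ramp_lipschitz lt_ab).
exists (fun n => coef_expect (P n) (fun k => ramp a b (coef_std (P n) k))).
  exact: coef_expect_ramp_cvg.
near=> n; have [rooted_n P1_gt0] : nonpos_rooted (P n) /\ 0 < (P n).[1] by near: n.
have P_distr := nonpos_rooted_has_coef_distr rooted_n P1_gt0.
have var_gt0 : 0 < coef_var (P n) by near: n; apply: cvgry_gt.
rewrite !coef_cdf_std //; apply/andP; split; apply: le_coef_expect => // k.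
- have /andP [ramp_ge0 _] := ramp_itv01 a b (coef_std (P n) k).
  case: (Order.TotalTheory.leP _ a) => // le_a.
  by rewrite ramp_left.
have /andP [_ ramp_le1] := ramp_itv01 a b (coef_std (P n) k).
by case: (Order.TotalTheory.leP _ b) => // /ltW le_b; rewrite ramp_right.
Unshelve. all: by end_near. Qed.

Lemma nonpos_rooted_asymptotically_normal : asymptotically_normal P.
Proof.
have P_distr : \forall n \near \oo, has_coef_distr (P n).
  by apply: filterS P_rooted => n [rooted_n]; apply: nonpos_rooted_has_coef_distr.
apply/asymptotically_normalP; split=> //; apply: polya_cdf_cvg_uniform.
- exact: continuous_std_normal_cdf.
- by apply: filterS P_distr => n distr_n; split=> [|x];
    [apply: coef_cdf_nondecreasing | apply: coef_cdf_itv01].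
- exact: std_normal_cdf_nondecreasing.
- exact: std_normal_cdf_itv01.
- exact: cvg_std_normal_cdfNy.
- exact: cvg_std_normal_cdfy.
- exact: coef_cdf_cvg.
Qed.

End nonpos_rooted_sequence.
End asymptotic_normality.

(** * Even and odd signed permutations *)

Definition parity_class (b : bool) (n : nat) : {set {perm letter n}} :=
  if b then signed_perms_minus n else signed_perms_plus n.

Section eulerianB_distribution.
Variable R : realType.
Local Notation B := (eulerianB R).

Lemma eulerianB_mean n : coef_mean (B n) = n%:R / 2.
Proof.
by rewrite coef_mean_deriv deriv_eulerianB_horner1 mulfK // gt_eqF // eulerianB_horner1_gt0.
Qed.

Lemma eulerianB_var n : (2 <= n)%N -> coef_var (B n) = (n%:R + 1) / 12.
Proof.
move=> n_ge2; have B1_neq0 : (B n).[1] != 0 by rewrite gt_eqF // eulerianB_horner1_gt0.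
rewrite coef_var_deriv // deriv2_eulerianB_horner1 // deriv_eulerianB_horner1.
by field.
Qed.

Lemma eulerianB_asymptotically_normal : asymptotically_normal (eulerianB R).
Proof.
apply: nonpos_rooted_asymptotically_normal.
  by near=> n; split; [apply: eulerianB_nonpos_rooted | apply: eulerianB_horner1_gt0].
apply/cvgryPge => A; near=> n.
rewrite eulerianB_var; last by near: n; exists 2%N.
rewrite ler_pdivlMr // -lerBlDr.
by near: n; apply: nbhs_infty_ger.
Unshelve. all: by end_near. Qed.

End eulerianB_distribution.

Lemma derivn_1subX_exp_horner1 (R : comNzRingType) n k :
  (k < n)%N -> (((1 - 'X) ^+ n)^`(k)).[1] = 0 :> R.
Proof.
elim: k n => [|k IHk] [|n] // lt_kn.
  by rewrite horner_exp hornerD hornerN hornerX hornerC subrr expr0n.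
rewrite derivSn deriv_exp derivD derivN derivX derivC add0r mulN1r derivnMn derivnN.
by rewrite hornerMn hornerN IHk // oppr0 mul0rn.
Qed.

Lemma norm_coef_pairing_1subX_exp (R : numDomainType) n (f : nat -> R) (M : R) :
  (forall k, `|f k| <= M) -> `|coef_pairing f ((1 - 'X) ^+ n)| <= 2 ^+ n * M.
Proof.
elim: n f M => [|n IHn] f M f_le.
  by rewrite mul1r expr0 -(expr0 'X) coef_pairingXn.
have -> : coef_pairing f ((1 - 'X) ^+ n.+1) =
    coef_pairing (fun k => f k + -1 * f k.+1) ((1 - 'X) ^+ n).
  rewrite exprS mulrBl mul1r linearB /= coef_pairing_mulX.
  by rewrite coef_pairing_addf coef_pairing_scalef mulN1r.
rewrite exprSr -mulrA; apply: IHn => k; rewrite mulN1r mulrDl mul1r.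
exact: le_trans (ler_normB _ _) (lerD _ _).
Qed.

Section eulerian_half.
Variables (R : realType) (b : bool).

Definition eulerian_half (n : nat) : {poly R} :=
  2^-1 *: (eulerianB R n + (-1) ^+ b *: (1 - 'X) ^+ n).
Local Notation Q := eulerian_half.
Local Notation B := (eulerianB R).

Lemma stat_poly_parity_class n (stat : {perm letter n} -> nat) :
  \sum_(pi in signed_perms n) 'X^(stat pi) = B n ->
  \sum_(pi in signed_perms n) (-1) ^+ inv_B pi * 'X^(stat pi) = (1 - 'X) ^+ n :> {poly R} ->
  stat_poly R (parity_class b n) stat = Q n.
Proof.
rewrite /eulerian_half => <- <-; rewrite scaler_sumr -big_split scaler_sumr /=.
rewrite /stat_poly (eq_bigl (fun pi => (pi \in signed_perms n) && (odd (inv_B pi) == b))).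
  rewrite big_mkcondr; apply: eq_bigr => pi _; rewrite -(signr_odd _ (inv_B pi)).
  have half_double (p : {poly R}) : p = 2^-1 *: (p + p).
    by rewrite -mulr2n -[p *+ 2]scaler_nat scalerA mulVf ?scale1r ?pnatr_eq0.
  case: (odd (inv_B pi)) b => [] []; rewrite /= ?expr0 ?expr1 ?mul1r ?mulN1r ?scale1r;
    by rewrite ?scaleN1r ?opprK ?subrr ?scaler0 // -half_double.
by move=> pi; case: b; rewrite !inE ?eqb_id ?eqbF_neg.
Qed.

Lemma derivn_eulerian_half_horner1 n k : (k < n)%N -> (Q n)^`(k).[1] = (B n)^`(k).[1] / 2.
Proof.
move=> lt_kn; rewrite derivnZ derivnD derivnZ !hornerE derivn_1subX_exp_horner1 //.
by rewrite mulr0 addr0 mulrC.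
Qed.

Lemma eulerian_half_horner1 n : (0 < n)%N -> (Q n).[1] = (B n).[1] / 2.
Proof. exact: derivn_eulerian_half_horner1. Qed.

Lemma eulerian_half_horner1_gt0 n : (0 < n)%N -> 0 < (Q n).[1].
Proof. by move=> n_gt0; rewrite eulerian_half_horner1 // divr_gt0 // eulerianB_horner1_gt0. Qed.

Lemma eulerian_half_mean n : (2 <= n)%N -> coef_mean (Q n) = coef_mean (B n).
Proof.
move=> n_ge2; rewrite !coef_mean_deriv (derivn_eulerian_half_horner1 (k := 1)) //.
rewrite eulerian_half_horner1 ?(ltnW n_ge2) // derivn1.
by field; rewrite gt_eqF // eulerianB_horner1_gt0.
Qed.

Lemma eulerian_half_var n : (3 <= n)%N -> coef_var (Q n) = coef_var (B n).
Proof.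
move=> n_ge3; have n_ge2 := ltnW n_ge3; have n_gt0 := ltnW n_ge2.
have B1_neq0 : (B n).[1] != 0 by rewrite gt_eqF // eulerianB_horner1_gt0.
rewrite !coef_var_deriv ?gt_eqF ?eulerian_half_horner1_gt0 ?eulerianB_horner1_gt0 //.
rewrite (derivn_eulerian_half_horner1 (k := 1)) // (derivn_eulerian_half_horner1 (k := 2)) //.
by rewrite eulerian_half_horner1 // derivn1 derivSn derivn1; field.
Qed.

Lemma eulerian_half_expect_close n f : (0 < n)%N -> (forall k, `|f k| <= 1) ->
  `|coef_expect (Q n) f - coef_expect (B n) f| <= exp_coeff 1 n.
Proof.
move=> n_gt0 f_le1; have B1_gt0 := eulerianB_horner1_gt0 R n.
have -> : coef_expect (Q n) f - coef_expect (B n) f =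
    (-1) ^+ b * coef_pairing f ((1 - 'X) ^+ n) / (B n).[1].
  rewrite /coef_expect eulerian_half_horner1 // linearZ linearD linearZ /=.
  by field; rewrite gt_eqF.
rewrite !normrM normr_sign mul1r normfV (gtr0_norm B1_gt0) ler_pdivrMr //.
apply: le_trans (norm_coef_pairing_1subX_exp n f_le1) _.
by rewrite eulerianB_horner1 /exp_coeff /= expr1n natrM natrX mulr1 mul1r mulrCA mulVf ?mulr1.
Qed.

Lemma eulerian_half_has_coef_distr n : (0 < n)%N -> has_coef_distr (Q n).
Proof.
split; last exact: eulerian_half_horner1_gt0.
rewrite -(stat_poly_parity_class (sum_exc_B R n) (alternating_sum_exc_B R n)).
exact: stat_poly_coef_ge0.
Qed.

End eulerian_half.

Lemma eulerian_half_asymptotically_normal (R : realType) (b : bool) :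
  asymptotically_normal (eulerian_half R b).
Proof.
apply: asymptotically_normal_perturb (eulerianB_asymptotically_normal R) _ _ _ (cvg_exp_coeff 1).
- by exists 1%N => // n; apply: eulerian_half_has_coef_distr.
- exists 3%N => // n n_ge3; split; last exact: eulerian_half_var.
  exact/eulerian_half_mean/ltnW.
- by exists 1%N => // n n_gt0 f; apply: eulerian_half_expect_close.
Qed.

Theorem theorem3p4 (R : realType) :
  [/\ asymptotically_normal (BExc_plus R),
      asymptotically_normal (BExc_minus R),
      asymptotically_normal (B_plus R) &
      asymptotically_normal (B_minus R)] /\
  (forall n : nat, (2 <= n)%N ->
    [/\ unif_mean R (signed_perms_plus n) (@exc_B n) = n%:R / 2,
        unif_mean R (signed_perms_minus n) (@exc_B n) = n%:R / 2,
        unif_mean R (signed_perms_plus n) (@des_B n) = n%:R / 2 &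
        unif_mean R (signed_perms_minus n) (@des_B n) = n%:R / 2]) /\
  (forall n : nat, (3 <= n)%N ->
    [/\ unif_var R (signed_perms_plus n) (@exc_B n) = (n%:R + 1) / 12,
        unif_var R (signed_perms_minus n) (@exc_B n) = (n%:R + 1) / 12,
        unif_var R (signed_perms_plus n) (@des_B n) = (n%:R + 1) / 12 &
        unif_var R (signed_perms_minus n) (@des_B n) = (n%:R + 1) / 12]).
Proof.
have excE b n : stat_poly R (parity_class b n) (@exc_B n) = eulerian_half R b n.
  exact: stat_poly_parity_class (sum_exc_B R n) (alternating_sum_exc_B R n).
have desE b n : stat_poly R (parity_class b n) (@des_B n) = eulerian_half R b n.
  exact: stat_poly_parity_class (sum_des_B R n) (alternating_sum_des_B R n).
have [excP excM] := (excE false, excE true); have [desP desM] := (desE false, desE true).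
have normal b P : P =1 eulerian_half R b -> asymptotically_normal P.
  by move=> /funext ->; apply: eulerian_half_asymptotically_normal.
split; last split=> n le_n.
- by split; [exact: normal excP | exact: normal excM | exact: normal desP | exact: normal desM].
- rewrite !unif_mean_stat_poly excP excM desP desM !eulerian_half_mean //.
  by rewrite eulerianB_mean.
- rewrite !unif_var_stat_poly excP excM desP desM !eulerian_half_var //.
  by rewrite eulerianB_var // ltnW.
Qed.
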